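(* Let $k\ge 2$ be an integer, let $\hat\alpha := 1+1/\sqrt6$, and let $p_{\bar\pi_{\hat\alpha}}(y\mid x)$ be the Bayesian predictive density based on the prior $$\bar\pi_{\hat\alpha}(\theta)\,d\theta_1\cdots d\theta_{k-1}\propto \theta_1^{1/\sqrt6}\cdots\theta_{k-1}^{1/\sqrt6}\Bigl(1-\sum_{i=1}^{k-1}\theta_i\Bigr)^{1/\sqrt6}d\theta_1\cdots d\theta_{k-1}$$ on $\Delta$. Suppose that $\{\varepsilon_N\}$ is a decreasing sequence of real numbers such that $\lim_{N\to\infty}N^{3/4}\varepsilon_N=\infty$, $\lim_{N\to\infty}N^{1/\hat\alpha}\varepsilon_N=0$, and $0<\varepsilon_N<1/k$ for every $N$. Then, as $N\to\infty$, $$\sup_{\theta\in\Delta_{\varepsilon_N}}R(\theta,p_{\bar\pi_{\hat\alpha}}(y\mid x))=\inf_{q}\sup_{\theta\in\Delta_{\varepsilon_N}}R(\theta,q(y;x))+\mathrm{o}(N^{-2}),$$ where the infimum is over all predictive densities $q(y;x)$.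
   Context: Fix an integer $k\ge 2$. The parameter space is $\Delta=\{\theta=(\theta_1,\ldots,\theta_{k-1}) : \theta_i\ge 0\ (i=1,\ldots,k)\}$ with $\theta_k:=1-\sum_{i=1}^{k-1}\theta_i$, and for $0<\varepsilon<1/k$, $\Delta_\varepsilon=\{\theta\in\Delta:\theta_i\ge\varepsilon\ (i=1,\ldots,k)\}$. For sample size $N$ and given $\theta$, the data $x=(x_1,\ldots,x_{k-1})$, with $x_k:=N-\sum_{i=1}^{k-1}x_i$, has the multinomial distribution $p(x|\theta)=\binom{N}{x_1,\ldots,x_k}\theta_1^{x_1}\cdots\theta_k^{x_k}$, where $\binom{N}{x_1,\ldots,x_k}=N!/(x_1!\cdots x_k!)$; the future observation $y=(y_1,\ldots,y_{k-1})$, with $y_k:=1-\sum_{i=1}^{k-1}y_i$, is independent of $x$ given $\theta$ and is multinomial with index $1$: $p(y|\theta)=\theta_1^{y_1}\cdots\theta_k^{y_k}$ (exactly one of $y_1,\ldots,y_k$ equals $1$, the others $0$). Thus $p(x,y|\theta)=p(x|\theta)p(y|\theta)$. A predictive density $q(y;x)$ is, for each possible $x$, a probability distribution in $y$. Its risk (average Kullback–Leibler divergence, depending on $N$) is $R(\theta,q(y;x))=\sum_y\sum_x p(x,y|\theta)\log\frac{p(y|\theta)}{q(y;x)}$. For a prior $\pi$, the Bayesian predictive density is $p_\pi(y\mid x)=\int p(y|\theta)\,\pi(\theta|x)\,d\theta$, where $\pi(\theta|x)\propto p(x|\theta)\pi(\theta)$ is the posterior density. For the symmetric Dirichlet prior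 with parameter $\alpha>0$, $\bar\pi_\alpha(\theta)=\frac{\Gamma(k\alpha)}{\Gamma(\alpha)^k}\theta_1^{\alpha-1}\cdots\theta_k^{\alpha-1}$ (density with respect to $d\theta_1\cdots d\theta_{k-1}$ on $\Delta$), one has $p_{\bar\pi_\alpha}(y\mid x)=\frac{\sum_{i=1}^k(x_i+\alpha)y_i}{N+k\alpha}$. *)

(* Defs.v *)
(* MathComp-Analysis; [R : realType] is the field of real numbers. *)
From HB Require Import structures.
From mathcomp Require Export all_boot all_order all_algebra.
From mathcomp Require Export all_classical all_reals all_analysis.

Set Implicit Arguments.
Unset Strict Implicit.
Unset Printing Implicit Defensive.

Export Order.TTheory GRing.Theory Num.Theory.
Export numFieldNormedType.Exports.

Local Open Scope classical_set_scope.
Local Open Scope ring_scope.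

(* Lebesgue measure on R^n, with R^n represented by [n.-tuple R] and its
   product sigma-algebra: the image of the product of the Lebesgue measures on
   R and R^(n-1) under (t, v) |-> t :: v. *)
Section LebesgueTuple.
Context (R : realType).

Section Step.
Context (n : nat) (mu : {sigma_finite_measure set (n.-tuple R) -> \bar R}).

Definition tcons (p : measurableTypeR R * n.-tuple R) : n.+1.-tuple R :=
  [tuple of (p.1 : R) :: p.2].

Lemma measurable_tcons : measurable_fun setT tcons.
Proof.
apply: (@measurable_cons _ _ _ _ (fun p => p.1 : R)).
- exact: (@measurable_fst _ _ (measurableTypeR R)).
- exact: measurable_snd.
Qed.

Definition lebesgue_tupleS : set (n.+1.-tuple R) -> \bar R :=
  pushforward (@lebesgue_measure R \x mu)%E tcons.

HB.instance Definition _ := isMeasurableFun.Build _ _ _ _ tcons measurable_tcons.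

Let lebesgue_tupleS0 : lebesgue_tupleS set0 = 0%E.
Proof. exact: measure0. Qed.

Let lebesgue_tupleS_ge0 A : (0 <= lebesgue_tupleS A)%E.
Proof. exact: measure_ge0. Qed.

Let lebesgue_tupleS_sigma_additive : semi_sigma_additive lebesgue_tupleS.
Proof. by apply: measure_semi_sigma_additive; exact: measurable_tcons. Qed.

HB.instance Definition _ := isMeasure.Build _ _ _ lebesgue_tupleS
  lebesgue_tupleS0 lebesgue_tupleS_ge0 lebesgue_tupleS_sigma_additive.

Lemma lebesgue_tupleS_sigma_finite : sigma_finite setT lebesgue_tupleS.
Proof.
have /sigma_finiteP[F [TF ndF Foo]] := sigma_finiteT (@lebesgue_measure R).
have /sigma_finiteP[G [TG ndG Goo]] := sigma_finiteT mu.
exists (fun i => [set v | F i (thead v) /\ G i [tuple of behead v]]).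
  rewrite predeqE => v; split => // _.
  have [m _ Fm] : (\bigcup_i F i) (thead v) by rewrite -TF.
  have [p _ Gp] : (\bigcup_i G i) [tuple of behead v] by rewrite -TG.
  exists (maxn m p) => //; split.
  - by move: (thead v) Fm; exact/subsetPset/ndF/leq_maxl.
  - by move: [tuple of behead v] Gp; exact/subsetPset/ndG/leq_maxr.
move=> i; have [mF Fi] := Foo i; have [mG Gi] := Goo i; split.
  apply: measurableI; rewrite -[X in measurable X]setTI.
  - exact: (@measurable_tnth _ R n.+1 ord0).
  - exact: measurable_behead.
rewrite /lebesgue_tupleS /pushforward (_ : _ @^-1` _ = F i `*` G i).
  by rewrite product_measure1E// lte_mul_pinfty// ge0_fin_numE.
have tK (t : R) (v : n.-tuple R) :
    [tuple of behead [tuple of t :: v]] = v by exact/val_inj.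
by apply/seteqP; split => -[t v]; rewrite /tcons /= theadE tK.
Qed.

HB.instance Definition _ := Measure_isSigmaFinite.Build _ _ _ lebesgue_tupleS
  lebesgue_tupleS_sigma_finite.
End Step.

Fixpoint lebesgue_tuple (n : nat) :
    {sigma_finite_measure set (n.-tuple R) -> \bar R} :=
  if n is m.+1 then lebesgue_tupleS (lebesgue_tuple m)
  else \d_([tuple] : 0.-tuple R).

End LebesgueTuple.

Section Model.
Context (R : realType) (k : nat).

(* A parameter theta = (theta_1, ..., theta_(k-1)) is a (k-1)-tuple.  For
   [i : 'I_k] the default value of [nth] is reached exactly when i is the last
   index, so this gives theta_1, ..., theta_(k-1), theta_k. *)
Definition coord (theta : k.-1.-tuple R) (i : 'I_k) : R :=
  nth (1 - \sum_(t <- theta) t) theta i.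

Definition Delta : set (k.-1.-tuple R) :=
  [set theta | forall i, 0 <= coord theta i].

Definition Delta_eps (eps : R) : set (k.-1.-tuple R) :=
  [set theta | Delta theta /\ forall i, eps <= coord theta i].

(* Values (x_1, ..., x_k), with x_1 + ... + x_k = n, of a multinomial variable
   of index n; for n = 1 exactly one entry is 1. *)
Definition counts (n : nat) : Type :=
  {x : {ffun 'I_k -> 'I_n.+1} | (\sum_i x i)%N == n}.

HB.instance Definition _ n := Finite.on (counts n).

Definition multinomial_pmf n (theta : k.-1.-tuple R) (x : counts n) : R :=
  n`!%:R / \prod_i (val x i)`!%:R * \prod_i coord theta i ^+ val x i.

Section Predictive.
Context (N : nat).

Definition predictive_density : set (counts N -> counts 1 -> R) :=
  [set q | forall x, (forall y, 0 <= q x y) /\ \sum_y q x y = 1].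

(* The logarithm is taken in \bar R, where r / 0 = +oo for r > 0, lne +oo = +oo,
   lne 0 = -oo and 0 * (+oo) = 0 * (-oo) = 0: a term is +oo if
   p(x, y | theta) > 0 = q(y; x), and 0 if p(x, y | theta) = 0. *)
Definition risk (theta : k.-1.-tuple R) (q : counts N -> counts 1 -> R) :
    \bar R :=
  (\sum_(y : counts 1) \sum_(x : counts N)
    (multinomial_pmf theta x * multinomial_pmf theta y)%:E *
    lne ((multinomial_pmf theta y)%:E / (q x y)%:E))%E.

Definition sup_risk (eps : R) (q : counts N -> counts 1 -> R) : \bar R :=
  ereal_sup [set risk theta q | theta in Delta_eps eps].

Definition minimax_risk (eps : R) : \bar R :=
  ereal_inf [set sup_risk eps q | q in predictive_density].

Definition posterior (prior : k.-1.-tuple R -> R) (x : counts N)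
    (theta : k.-1.-tuple R) : R :=
  multinomial_pmf theta x * prior theta /
  (\int[lebesgue_tuple R k.-1]_(t in Delta) (multinomial_pmf t x * prior t))%R.

Definition bayes_predictive (prior : k.-1.-tuple R -> R)
    (x : counts N) (y : counts 1) : R :=
  (\int[lebesgue_tuple R k.-1]_(theta in Delta)
    (multinomial_pmf theta y * posterior prior x theta))%R.

End Predictive.

(* The normalizing constant is written as an integral; it equals
   Gamma(alpha) ^ k / Gamma(k * alpha). *)
Definition dirichlet_density (alpha : R) (theta : k.-1.-tuple R) : R :=
  (\prod_i coord theta i `^ (alpha - 1)) /
  (\int[lebesgue_tuple R k.-1]_(t in Delta) \prod_i coord t i `^ (alpha - 1))%R.

End Model.

Arguments Delta {R}.
Arguments Delta_eps {R}.
Arguments predictive_density {R}.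
Arguments minimax_risk {R}.
Arguments bayes_predictive {R k}.
Arguments dirichlet_density {R}.

Definition alpha_hat (R : realType) : R := 1 + (Num.sqrt 6)^-1.
Arguments alpha_hat {R}.

(* Main.v *)
From HB Require Import structures.
Require Import Defs.
From mathcomp Require Import ring lra zify measurable_realfun.

(* The posterior mean of the symmetric Dirichlet(a) prior has marginal risk
   governed by F_N(p) = E ln(X + a) for X binomial (N, p).  Since
   F_N'(p) = N E_(N-1) [ln(X + 1 + a) - ln(X + a)], rational bounds of the
   increment of ln whose binomial expectation is explicit integrate, from p to
   1 where F_N is ln(N + a), to
     ln((N + a) p) + (a - 1/2) (1/p - 1) / (N + 1) <= F_N(p)
       <= the same + 4 / (N p)^3.
   The second-order term in 1/p vanishes because a = 1 + 1/sqrt 6 is a root of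
   a^2 - 2 a + 5/6, so that the risk is at most a constant U_N on the truncated
   simplex, and at least U_N minus a sum of 4 / (N^3 theta_i^2).

   For the lower bound on the minimax risk, average over the Dirichlet prior
   restricted to theta_i >= eps.  The gain of any predictive density over the
   Dirichlet one is, by Gibbs' inequality and KL <= chi^2, at most a sum of
   squared covariances of theta_i and the truncation indicator; Cauchy-Schwarz
   and the posterior variance p (1 - p) / (N + k a + 1) bound it by k / N times
   the truncated prior mass, which is O(eps^a).  Hence the loss is
   O(eps^a / N + 1 / (N^3 eps)) = o(N^-2). *)

Set Implicit Arguments.
Unset Strict Implicit.
Unset Printing Implicit Defensive.
Local Open Scope classical_set_scope.
Local Open Scope ring_scope.

(** The two risk bounds are deliberately asymmetric. At [theta_i = eps] the error
    [4 / (N^3 theta_i^2)] is [4 / (N^3 eps^2)], which is larger than [N^-2], since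
    [eps = o(N^(-1/a))] with [a < 2]; as a uniform error it would be too weak. Hence the upper bound
    on the risk carries no error: the correction [(1 - p)^N] coming from the point 0 has a
    favourable sign once [N p >= 20]. The lower bound is used only after averaging over the prior,
    where [theta_i^-2] integrates to at most [1 / eps] instead of [1 / eps^2]. The first-order term
    does not spoil the constancy of the risk, because [theta_i (1 / theta_i - 1)] sums to [k - 1]
    for every [theta]. The prior is truncated because a minimax lower bound on [Delta_eps] needs an
    average over [Delta_eps]. The average is taken with the unnormalized Dirichlet weight, so that
    posterior moments are ratios of integrals governed by the Beta recursion. *)

Section AlphaHat.
Context {R : realType}.

Lemma alpha_hat_eq0 : (alpha_hat : R) ^+ 2 - 2 * alpha_hat + 5 / 6 = 0.
Proof.
have s6 : Num.sqrt (6 : R) ^+ 2 = 6 by rewrite sqr_sqrtr.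
have s0 : Num.sqrt (6 : R) != 0 by rewrite sqrtr_eq0 -ltNge.
have /(congr1 (fun z => z^-1)) := s6; rewrite -exprVn /alpha_hat => s6V.
by rewrite sqrrD s6V expr1n; lra.
Qed.

(** The value is about 1.408. The lower bound exceeds 7/6, the sign threshold in [pade_incr]; the
    upper one gives [1 - c >= 1/20] for [c = alpha_hat - 1/2], which matches the threshold 20 on
    [N p]. The fact [1 < alpha_hat] excludes the other root, [1 - 1/sqrt 6]. *)
Lemma alpha_hat_bounds : 7 / 5 <= (alpha_hat : R) <= 29 / 20.
Proof.
have := alpha_hat_eq0; have : 1 < (alpha_hat : R).
  by rewrite /alpha_hat ltrDl invr_gt0 sqrtr_gt0.
by move: alpha_hat => a a1 ha; apply/andP; split; nra.
Qed.

End AlphaHat.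

(** * Rational bounds for [ln (1 + t)] *)

Section LogBounds.
Context {R : realType}.
Implicit Types t x : R.

Lemma le_of_derive_le (f g f' g' : R -> R) (a b : R) : a <= b ->
  (forall t, a <= t <= b -> is_derive t 1 f (f' t)) ->
  (forall t, a <= t <= b -> is_derive t 1 g (g' t)) ->
  (forall t, a <= t <= b -> f' t <= g' t) ->
  f b - f a <= g b - g a.
Proof.
move=> ab df dg fg.
have [||c cab] := @MVT_segment R (fun t => g t - f t) (fun t => g' t - f' t) a b ab.
- move=> t; rewrite in_itv/= => /andP[at_ tb].
  by have := df t; have := dg t; rewrite !ltW// => /(_ isT) ? /(_ isT) ?;
    apply: is_deriveB.
- apply: continuous_in_subspaceT => t; rewrite inE/= in_itv/= => tab.
  apply/differentiable_continuous/derivable1_diffP.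
  by have := df t tab; have := dg t tab => ? ?; apply: ex_derive.
rewrite in_itv/= in cab => e.
have : 0 <= (g' c - f' c) * (b - a) by rewrite mulr_ge0 ?subr_ge0 ?fg.
by rewrite -e; lra.
Qed.

(** The [2/1] Padé approximant of [ln (1 + t)] at 0; the two agree up to the order [t^3]. *)
Let pade t : R := t * (6 + t) / (6 + 4 * t).

(** The derivative is displayed as that of [ln (1 + t)] plus an excess lying between 0 and
    [t^3 / 9], since [(1 + t)(6 + 4t)^2 >= 36]. Integrating the excess yields both bounds below, the
    second with error [t^4 / 36]. *)
Let is_derive_pade t : 0 <= t -> is_derive t 1 pade
  ((1 + t)^-1 + 4 * t ^+ 3 / ((1 + t) * (6 + 4 * t) ^+ 2)).
Proof.
move=> t0; have h : 6 + 4 * t != 0 by rewrite gt_eqF//; lra.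
have h1 : 1 + t != 0 by rewrite gt_eqF//; lra.
rewrite /pade.
apply: is_derive_eq.
rewrite /GRing.scale/=.
by field; rewrite h h1.
Qed.

Let is_derive_ln1D t : 0 <= t -> is_derive t 1 (fun u => ln (1 + u)) (1 + t)^-1.
Proof.
move=> t0; have h : 0 < 1 + t by lra.
have := is_derive1_ln h => d.
apply: (@is_derive_eq _ _ _ _ _ _ _ _ (is_derive1_comp _ _)).
by rewrite /GRing.scale/=; ring.
Qed.

Lemma ln1D_le_pade t : 0 <= t -> ln (1 + t) <= t * (6 + t) / (6 + 4 * t).
Proof.
move=> t0.
have := @le_of_derive_le (fun u => ln (1 + u)) pade (fun u => (1 + u)^-1)
  (fun t => (1 + t)^-1 + 4 * t ^+ 3 / ((1 + t) * (6 + 4 * t) ^+ 2)) 0 t t0.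
rewrite addr0 ln1 /pade mul0r mul0r !subr0; apply.
- by move=> u /andP[u0 _]; exact: is_derive_ln1D.
- by move=> u /andP[u0 _]; exact: is_derive_pade.
- move=> u /andP[u0 _]; rewrite lerDl divr_ge0 ?mulr_ge0 ?exprn_ge0//; lra.
Qed.

Lemma ln1D_ge_pade t : 0 <= t ->
  t * (6 + t) / (6 + 4 * t) - t ^+ 4 / 36 <= ln (1 + t).
Proof.
move=> t0.
have := @le_of_derive_le pade (fun u => ln (1 + u) + u ^+ 4 / 36)
  (fun t => (1 + t)^-1 + 4 * t ^+ 3 / ((1 + t) * (6 + 4 * t) ^+ 2))
  (fun u => (1 + u)^-1 + u ^+ 3 / 9) 0 t t0.
rewrite addr0 ln1 expr0n/= /pade !mul0r addr0 !subr0 lerBlDr; apply.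
- by move=> u /andP[u0 _]; exact: is_derive_pade.
- move=> u /andP[u0 _]; have d := is_derive_ln1D u0.
  apply: is_derive_eq; rewrite /GRing.scale/=.
  by move: (_^-1) => z; lra.
- move=> u /andP[u0 _]; rewrite lerD2l.
  have u3 : 0 <= u ^+ 3 by rewrite exprn_ge0.
  rewrite ler_pdivrMr ?mulr_gt0 ?exprn_gt0//; try lra.
  rewrite mulrAC ler_pdivlMr// -mulrA mulrC -mulrA ler_wpM2l//.
  have : 0 <= u ^+ 2 * u by rewrite mulr_ge0// exprn_ge0.
  have : 0 <= u ^+ 2 by rewrite exprn_ge0.
  have -> : (1 + u) * (6 + 4 * u) ^+ 2 = 36 + 84 * u + 64 * u ^+ 2 + 16 * (u ^+ 2 * u) by ring.
  lra.
Qed.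

End LogBounds.

(** * Increments of [ln (x + alpha_hat)] against reciprocals of rising products *)

Section LogIncrement.
Context {R : realType}.
Local Notation a := (alpha_hat : R).
Local Notation c := (alpha_hat - 1 / 2 : R).

Let incr_ln (x : R) : 0 <= x -> ln (x + 1 + a) - ln (x + a) = ln (1 + (x + a)^-1).
Proof.
move=> x0; have /andP[a1 _] := @alpha_hat_bounds R.
rewrite -ln_div ?posrE//; try lra.
by congr ln; field; apply/lt0r_neq0; lra.
Qed.

(* The two sides differ by exactly (a - 7/6) / ((x+1)(x+2)(x+a)(6x+6a+4))
   because a^2 = 2a - 5/6: this is what singles out alpha_hat. *)
Let pade_incr (x : R) : 0 <= x ->
  let t := (x + a)^-1 in
  t * (6 + t) / (6 + 4 * t) = (x + 1)^-1 - c / ((x + 1) * (x + 2))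
    - (a - 7 / 6) / ((x + 1) * (x + 2) * (x + a) * (6 * x + 6 * a + 4)).
Proof.
move=> x0 /=; have /andP[a1 _] := @alpha_hat_bounds R; have := @alpha_hat_eq0 R.
move: alpha_hat a1 => b b1 eb.
have -> : (x + 1)^-1 - (b - 1 / 2) / ((x + 1) * (x + 2))
    - (b - 7 / 6) / ((x + 1) * (x + 2) * (x + b) * (6 * x + 6 * b + 4)) =
  ((x + 5 / 2 - b) * (x + b) * (6 * x + 6 * b + 4) - (b - 7 / 6)) /
    ((x + 1) * (x + 2) * (x + b) * (6 * x + 6 * b + 4)).
  by field; rewrite !lt0r_neq0//; lra.
have -> : (x + 5 / 2 - b) * (x + b) * (6 * x + 6 * b + 4) - (b - 7 / 6) =
    (6 * x + 6 * b + 1) * (x + 1) * (x + 2).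
  apply/eqP; rewrite -subr_eq0; apply/eqP.
  transitivity ((b ^+ 2 - 2 * b + 5 / 6) * (- 6 * x - 6 * b - 1)); last by rewrite eb mul0r.
  by field.
by field; rewrite !lt0r_neq0//; lra.
Qed.

Lemma incr_ln_le (x : R) : 0 <= x ->
  ln (x + 1 + a) - ln (x + a) <= (x + 1)^-1 - c / ((x + 1) * (x + 2)).
Proof.
move=> x0; have /andP[a1 _] := @alpha_hat_bounds R.
rewrite incr_ln//; apply: le_trans (ln1D_le_pade _) _.
  by rewrite invr_ge0; lra.
rewrite pade_incr// gerBl divr_ge0 ?mulr_ge0//; lra.
Qed.

Lemma incr_ln_ge (x : R) : 0 <= x ->
  (x + 1)^-1 - c / ((x + 1) * (x + 2)) -
    5 / ((x + 1) * (x + 2) * (x + 3) * (x + 4)) <= ln (x + 1 + a) - ln (x + a).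
Proof.
move=> x0; have /andP[a1 a2] := @alpha_hat_bounds R.
rewrite incr_ln//; apply: le_trans (ln1D_ge_pade _); last first.
  by rewrite invr_ge0; lra.
rewrite pade_incr//.
move: alpha_hat a1 a2 => b b1 b2.
set L := (b - 1 / 2) / _; set U := (b - 7 / 6) / _; set V := (_ ^-1) ^+ 4 / 36.
set W := 5 / _; suff UVW : U + V <= W by clearbody L U V W; lra.
rewrite {L}/U/V/W.
(* The constant 5 is 4 + 1: the 4 absorbs the remainder of [pade_incr], and the 1, written 36/36,
   absorbs [t^4 / 36]. The latter holds because [x + j <= j (x + b)] for [j] from 1 to 4, and
   [1 * 2 * 3 * 4 <= 36]. *)
have -> : 5 / ((x + 1) * (x + 2) * (x + 3) * (x + 4)) =
  4 / ((x + 1) * (x + 2) * (x + 3) * (x + 4)) + 36 / ((x + 1) * (x + 2) * (x + 3) * (x + 4)) / 36.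
  by field; rewrite !lt0r_neq0//; lra.
apply: lerD.
  rewrite ler_pdivrMr; last by rewrite !mulr_gt0//; lra.
  rewrite mulrAC ler_pdivlMr; last by rewrite !mulr_gt0//; lra.
  have -> : 4 * ((x + 1) * (x + 2) * (x + b) * (6 * x + 6 * b + 4)) =
    (x + 1) * (x + 2) * (4 * (x + b) * (6 * x + 6 * b + 4)) by ring.
  have -> : (b - 7 / 6) * ((x + 1) * (x + 2) * (x + 3) * (x + 4)) =
    (x + 1) * (x + 2) * ((x + 3) * ((b - 7 / 6) * (x + 4))) by ring.
  rewrite ler_wpM2l ?mulr_ge0//; [lra..|].
  rewrite mulrC; apply: ler_pM; rewrite ?mulr_ge0//; try lra; nra.
rewrite ler_pM2r// exprVn -(mul1r (_ ^- 4)).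
rewrite ler_pdivrMr; last by rewrite exprn_gt0//; lra.
rewrite mulrAC ler_pdivlMr; last by rewrite !mulr_gt0//; lra.
rewrite mul1r; apply: (@le_trans _ _ (1 * 2 * 3 * 4 * (x + b) ^+ 4)); last first.
  by rewrite ler_wpM2r ?exprn_ge0//; lra.
have -> : 1 * 2 * 3 * 4 * (x + b) ^+ 4 =
  (x + b) * (2 * (x + b)) * (3 * (x + b)) * (4 * (x + b)) by ring.
by rewrite !ler_pM ?mulr_ge0//; lra.
Qed.

End LogIncrement.

(** * Binomial expectations as polynomials in [p] *)

Section BinomialExpectation.
Context {R : realType}.
Implicit Types (g h : nat -> R) (p : R) (N : nat).

(** The expectation of [g X] for [X] binomial (N, p), obtained by conditioning on one trial. In this
    form identities and the derivative in [p] follow by induction on [N], and the recursion is the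
    one that [multES] produces for a multinomial marginal. *)
Fixpoint binE N p g : R :=
  if N is M.+1 then p * binE M p (g \o S) + (1 - p) * binE M p g else g 0%N.

Lemma binES N p g :
  binE N.+1 p g = p * binE N p (g \o S) + (1 - p) * binE N p g.
Proof. by []. Qed.

Lemma eq_binE N p g h : g =1 h -> binE N p g = binE N p h.
Proof. by elim: N g h => //= N IH g h gh; congr (_ * _ + _ * _); apply: IH => x //=. Qed.

Lemma binED N p g h : binE N p (fun x => g x + h x) = binE N p g + binE N p h.
Proof.
elim: N g h => //= N IH g h; rewrite (IH g h).
by rewrite [binE N p _](IH (g \o S) (h \o S)); ring.
Qed.

Lemma binEZ N p r g : binE N p (fun x => r * g x) = r * binE N p g.
Proof.
elim: N g => //= N IH g; rewrite (IH g).
by rewrite [binE N p _](IH (g \o S)); ring.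
Qed.

Lemma binE_cst N p r : binE N p (fun=> r) = r.
Proof. by elim: N => //= N IH; rewrite [binE N p _]IH; ring. Qed.

Lemma le_binE N p g h : 0 <= p <= 1 -> (forall x, g x <= h x) ->
  binE N p g <= binE N p h.
Proof.
move=> /andP[p0 p1]; elim: N g h => //= N IH g h gh.
by apply: lerD; apply: ler_wpM2l; rewrite ?subr_ge0//; apply: IH => x/=.
Qed.

Lemma binE1 N g : binE N 1 g = g N.
Proof. by elim: N g => //= N IH g; rewrite IH subrr mul1r mul0r addr0. Qed.

Lemma binE_eq0 N p : binE N p (fun x => (x == 0)%:R) = (1 - p) ^+ N.
Proof.
elim: N => [|N IH] /=; first by rewrite expr0.
by rewrite IH (@eq_binE _ _ _ (fun=> 0))// binE_cst mulr0 add0r exprS.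
Qed.

(** The size-bias identity. With a factor [1 / x] inside [h] it computes expectations of
    reciprocals, trading each factor of a rising product for one more trial and a division by
    [p]. *)
Lemma binE_stein N p h :
  binE N.+1 p (fun x => x%:R * h x) = N.+1%:R * p * binE N p (h \o S).
Proof.
elim: N h => [|N IH] h; first by rewrite /=; ring.
rewrite binES IH (@eq_binE _ _ ((fun x => x%:R * h x) \o S)
  (fun x => x%:R * (h \o S) x + (h \o S) x)); last first.
  by move=> x /=; rewrite -[in LHS]natr1 mulrDl mul1r.
rewrite binED IH binES -!(natr1 N.+1); ring.
Qed.

Lemma is_derive_binE N g p : is_derive p 1 (fun q => binE N.+1 q g)
  (N.+1%:R * binE N p (fun x => g x.+1 - g x)).
Proof.
elim: N g p => [|N IH] g p.
  by rewrite /=; apply: is_derive_eq; rewrite /GRing.scale/=; ring.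
have d1 := IH (g \o S) p; have d2 := IH g p.
rewrite (_ : (fun q => _) = (fun q => q * binE N.+1 q (g \o S) + (1 - q) * binE N.+1 q g))//.
apply: is_derive_eq; rewrite /GRing.scale [X in _ = _ * X]/=.
rewrite (@eq_binE N p (fun x => (g \o S) x.+1 - (g \o S) x)
  ((fun x => g x.+1 - g x) \o S))//.
have -> : binE N.+1 p (g \o S) = binE N.+1 p (fun x => g x.+1 - g x) + binE N.+1 p g.
  by rewrite -binED; apply: eq_binE => x /=; rewrite subrK.
by rewrite -(natr1 N.+1) /=; ring.
Qed.

End BinomialExpectation.

(** * Two-sided bounds for the binomial expectation of [ln (X + alpha_hat)] *)

Section BinomialLog.
Context {R : realType}.
Implicit Types (p : R) (N : nat).
Local Notation a := (alpha_hat : R).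
Local Notation c := (alpha_hat - 1 / 2 : R).

(** The reciprocal of the rising product [(x + 1) ... (x + j)]. *)
Definition inv_rise (j x : nat) : R := x`!%:R / (x + j)`!%:R.

Let fact_neq0 n : n`!%:R != 0 :> R.
Proof. by rewrite pnatr_eq0 -lt0n fact_gt0. Qed.

(** The left side equals [inv_rise j N] times the probability of at least [j] successes in [N + j]
    trials. Each induction step applies [binE_stein] and gives away only the value at 0. *)
Lemma binE_inv_rise_le N p j : 0 <= p <= 1 ->
  p ^+ j * binE N p (inv_rise j) <= inv_rise j N.
Proof.
move=> p01; have /andP[p0 p1] := p01; elim: j N => [|j IH] N.
  rewrite expr0 mul1r (@eq_binE _ _ _ _ (fun=> 1)) ?binE_cst /inv_rise ?addn0 ?divff//.
  by move=> x; rewrite addn0 divff.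
pose h y : R := inv_rise j y / y%:R.
have e : binE N p (inv_rise j.+1) = binE N p (h \o S).
  apply: eq_binE => x; rewrite /h /inv_rise /= addnS addSn [x.+1`!]factS natrM.
  by field; rewrite fact_neq0 addrC natr1 pnatr_eq0.
have := binE_stein N p h; rewrite -e => s.
have /(ler_wpM2l (exprn_ge0 j p0)) : binE N.+1 p (fun x => x%:R * h x) <= binE N.+1 p (inv_rise j).
  by apply: le_binE => // -[|x]; rewrite /h ?mul0r ?divr_ge0// mulrCA divff ?mulr1.
move=> /le_trans/(_ (IH N.+1)); rewrite s.
have -> : inv_rise j N.+1 = N.+1%:R * inv_rise j.+1 N.
  by rewrite /inv_rise addnS addSn [N.+1`!]factS natrM mulrA.
have -> : p ^+ j * (N.+1%:R * p * binE N p (inv_rise j.+1)) =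
    N.+1%:R * (p ^+ j.+1 * binE N p (inv_rise j.+1)) by rewrite exprS; ring.
by rewrite ler_pM2l.
Qed.

Lemma inv_rise1E x : inv_rise 1 x = (x%:R + 1)^-1.
Proof.
rewrite /inv_rise addn1 factS natrM -natr1; field.
by rewrite fact_neq0 natr1 pnatr_eq0.
Qed.

Lemma inv_riseSE j x : inv_rise j.+1 x = inv_rise j x / (x%:R + j%:R + 1).
Proof.
rewrite /inv_rise addnS factS natrM -natr1 natrD; field.
by rewrite fact_neq0 -natrD natr1 pnatr_eq0.
Qed.

Lemma inv_rise_le j x : inv_rise j x <= (x%:R + 1) ^- j.
Proof.
elim: j => [|j IH]; first by rewrite /inv_rise addn0 divff// expr0 invr1.
rewrite inv_riseSE exprSr invfM ler_pM ?invr_ge0 ?addr_ge0 ?divr_ge0//.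
rewrite lef_pV2 ?posrE ?ltr_wpDl ?addr_ge0//.
by rewrite lerD2r lerDl.
Qed.

Lemma inv_rise2E x : inv_rise 2 x = ((x%:R + 1) * (x%:R + 2))^-1.
Proof. by rewrite inv_riseSE inv_rise1E -invfM -addrA. Qed.

Lemma inv_rise4E x : inv_rise 4 x =
  ((x%:R + 1) * (x%:R + 2) * (x%:R + 3) * (x%:R + 4))^-1.
Proof. by rewrite (inv_riseSE 3) (inv_riseSE 2) inv_rise2E -!invfM -!addrA !natr1. Qed.

Lemma binE_inv_rise1 N p : 0 < p ->
  N.+1%:R * binE N p (inv_rise 1) = (1 - (1 - p) ^+ N.+1) / p.
Proof.
move=> p0; have := binE_stein N p (fun y => y%:R^-1).
(* Since [0^-1 = 0], the product [x * x^-1] is 0 at [x = 0] and 1 elsewhere; the indicator accounts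
   for this and has expectation [(1 - p)^(N+1)]. *)
rewrite (@eq_binE _ _ _ _ (fun x => 1 + -1 * (x == 0%N)%:R)); last first.
  by move=> [|x] /=; rewrite ?mul0r ?mulfV ?pnatr_eq0//; ring.
rewrite binED binEZ binE_cst binE_eq0 mulN1r => ->.
rewrite (@eq_binE _ _ _ _ (inv_rise 1)).
  by field; rewrite gt_eqF.
by move=> x /=; rewrite inv_rise1E natr1.
Qed.

(** An exact value, because [dF_le] uses this expectation with the negative coefficient [-c], for
    which the inequality of [binE_inv_rise_le] points the wrong way. *)
Lemma binE_inv_rise2 N p : 0 < p ->
  N.+1%:R * binE N p (inv_rise 2) =
  (1 - (1 - p) ^+ N.+2) / (N.+2%:R * p ^+ 2) - (1 - p) ^+ N.+1 / p.
Proof.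
move=> p0; have := binE_stein N p (fun y => inv_rise 1 y / y%:R).
rewrite (@eq_binE _ _ _ _ (fun x => inv_rise 1 x + -1 * (x == 0%N)%:R)); last first.
  move=> [|x] /=; first by rewrite inv_rise1E add0r invr1 mul0r; ring.
  by rewrite mulr0 addr0 mulrCA divff ?mulr1// pnatr_eq0.
rewrite binED binEZ binE_eq0 mulN1r.
have := binE_inv_rise1 N.+1 p0.
move=> /(congr1 (fun z => z / N.+2%:R)); rewrite mulrAC divff ?pnatr_eq0// mul1r => ->.
rewrite (@eq_binE _ N _ _ (inv_rise 2)).
  move=> e; have : (1 - (1 - p) ^+ N.+2) / (N.+2%:R * p ^+ 2) - (1 - p) ^+ N.+1 / p
    = ((1 - (1 - p) ^+ N.+2) / p / N.+2%:R - (1 - p) ^+ N.+1) / p.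
    by field; rewrite gt_eqF//= addrC natr1 addrC natr1 pnatr_eq0.
  by move=> ->; rewrite e; field; rewrite gt_eqF.
move=> x /=; rewrite inv_rise1E inv_rise2E -natr1 -invfM mulrC.
by rewrite -addrA.
Qed.

Let F N p := binE N p (fun x => ln (x%:R + a)).
(** The derivative of [F N.+1], not of [F N]: differentiating removes one trial. *)
Let dF N p := N.+1%:R * binE N p (fun x => ln (x.+1%:R + a) - ln (x%:R + a)).

(** The exact expectations leave two corrections in [q = (1 - p)^(N+1)]: the one from [inv_rise 1]
    helps, the one from [inv_rise 2] hurts. Their balance has the sign of
    [(1 - c) (N + 2) p - c (1 - p)], which is nonnegative because [20 (1 - c) >= 1 >= c]. *)
Let dF_le N p : 0 < p <= 1 -> 20 <= N.+1%:R * p ->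
  dF N p <= p^-1 - c / (N.+2%:R * p ^+ 2).
Proof.
move=> /andP[p0 p1] Np; have /andP[a1 a2] := @alpha_hat_bounds R.
have p01 : 0 <= p <= 1 by rewrite p1 ltW.
have : binE N p (fun x => ln (x.+1%:R + a) - ln (x%:R + a)) <=
    binE N p (fun x => inv_rise 1 x + - c * inv_rise 2 x).
  apply: le_binE => // x; rewrite inv_rise1E inv_rise2E mulNr -natr1.
  exact: incr_ln_le.
have N0 : 0 < N.+1%:R :> R by rewrite ltr0n.
rewrite -(ler_pM2l N0) [X in _ <= _ * X -> _]binED binEZ mulrDr mulrCA.
rewrite binE_inv_rise1// binE_inv_rise2// => /le_trans; apply.
have q0 : 0 <= (1 - p) ^+ N.+1 by rewrite exprn_ge0// subr_ge0.
have N2 : 0 < N.+2%:R :> R by rewrite ltr0n.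
have N20 : 20 <= N.+2%:R * p by rewrite -[N.+2]addn1 natrD mulrDl mul1r; lra.
rewrite (exprS _ N.+1); set q := _ ^+ N.+1 in q0 *; rewrite -subr_ge0.
have -> : p^-1 - c / (N.+2%:R * p ^+ 2) - ((1 - q) / p +
    - c * ((1 - (1 - p) * q) / (N.+2%:R * p ^+ 2) - q / p)) =
    q / (N.+2%:R * p ^+ 2) * ((1 - c) * (N.+2%:R * p) - c * (1 - p)).
  by field; rewrite gt_eqF//= addrC natr1 addrC natr1 pnatr_eq0.
apply: mulr_ge0.
  by rewrite divr_ge0// mulr_ge0 ?exprn_ge0// ltW.
move: alpha_hat a1 a2 (N.+2%:R * p) N20 => b b1 b2 m m20.
rewrite subr_ge0; apply: (@le_trans _ _ ((1 - (b - 1 / 2)) * 20)); last first.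
  by rewrite ler_wpM2l//; lra.
apply: (@le_trans _ _ (b - 1 / 2)); last by lra.
by rewrite ler_piMr; lra.
Qed.

(** The constant is 11 = 5 + 6, with 5 from the last term of [incr_ln_ge] and 6 from the bound on
    [(1 - p)^(N+1) / p]. *)
Let dF_ge N p : 0 < p <= 1 ->
  p^-1 - c / (N.+2%:R * p ^+ 2) - 11 / (N.+1%:R ^+ 3 * p ^+ 4) <= dF N p.
Proof.
move=> /andP[p0 p1]; have /andP[a1 a2] := @alpha_hat_bounds R.
have p01 : 0 <= p <= 1 by rewrite p1 ltW.
have : binE N p (fun x => inv_rise 1 x + (- c * inv_rise 2 x + - 5 * inv_rise 4 x)) <=
    binE N p (fun x => ln (x.+1%:R + a) - ln (x%:R + a)).
  apply: le_binE => // x; rewrite inv_rise1E inv_rise2E inv_rise4E !mulNr addrA -[x.+1]addn1 natrD.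
  exact: incr_ln_ge.
have N0 : 0 < N.+1%:R :> R by rewrite ltr0n.
rewrite -(ler_pM2l N0) [X in _ * X <= _ -> _]binED [X in _ + X]binED !binEZ !mulrDr.
apply: le_trans; rewrite binE_inv_rise1// !(mulrCA N.+1%:R).
have B2 : N.+1%:R * binE N p (inv_rise 2) <= (N.+2%:R * p ^+ 2)^-1.
  have := binE_inv_rise_le N 2 p01; rewrite inv_rise2E.
  rewrite -(ler_pM2l N0) mulrCA mulrC -ler_pdivlMr ?exprn_gt0// => /le_trans; apply.
  rewrite invfM mulrA -[2]/(1 + 1)%:R natrD addrA !natr1 mulfV ?mul1r; last by rewrite gt_eqF.
  by rewrite [leRHS]invfM lexx.
have B4 : N.+1%:R * binE N p (inv_rise 4) <= (N.+1%:R ^+ 3 * p ^+ 4)^-1.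
  have := le_trans (binE_inv_rise_le N 4 p01) (inv_rise_le 4 N).
  rewrite -(ler_pM2l N0) mulrCA mulrC -ler_pdivlMr ?exprn_gt0// => /le_trans; apply.
  by rewrite natr1 exprS invfM mulrA mulfV ?mul1r ?[leRHS]invfM ?lexx// gt_eqF.
(* (1 - p)^(N+1) is the probability of 0, where inv_rise 3 equals 1/6 *)
have Q : (1 - p) ^+ N.+1 / p <= 6 / (N.+1%:R ^+ 3 * p ^+ 4).
  rewrite -binE_eq0.
  have : binE N.+1 p (fun x => (x == 0%N)%:R) <= binE N.+1 p (fun x => 6 * inv_rise 3 x).
    apply: le_binE => // -[|x] /=; last by rewrite mulr_ge0 ?divr_ge0.
    by rewrite /inv_rise add0n fact0 (_ : 3`! = 6)%N //; lra.
  rewrite binEZ.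
  have := le_trans (binE_inv_rise_le N.+1 3 p01) (inv_rise_le 3 N.+1).
  rewrite mulrC -ler_pdivlMr ?exprn_gt0// => h1 h2.
  rewrite ler_pdivrMr//; apply: le_trans h2 _.
  have -> : 6 / (N.+1%:R ^+ 3 * p ^+ 4) * p = 6 * (N.+1%:R ^- 3 / p ^+ 3).
    by field; rewrite !gt_eqF//= addrC natr1.
  rewrite ler_pM2l//; apply: le_trans h1 _.
  rewrite ler_pM2r ?invr_gt0 ?exprn_gt0// natr1 lef_pV2 ?posrE ?exprn_gt0//.
  by rewrite lerXn2r ?nnegrE ?ler_nat.
have c0 : 0 <= c by lra.
have := ler_wpM2l c0 B2; move: B4 Q; rewrite [(1 - _) / p]mulrBl.
move: (binE _ _ _) (binE _ _ _) c ((1 - p) ^+ _ / p) => b4 b2 d q.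
move: (_ / (_ * p ^+ 2)) (_ ^-1) => Z Y.
lra.
Qed.

Let is_derive_F N p : is_derive p 1 (F N.+1) (dF N p).
Proof. exact: is_derive_binE. Qed.

Let is_derive_main (d : R) p : 0 < p ->
  is_derive p 1 (fun t => ln t + d / t) (p^-1 - d / p ^+ 2).
Proof.
move=> p0; have := is_derive1_ln p0 => dl.
have p1 : p != 0 by rewrite gt_eqF.
have dV : is_derive p 1 (fun t => t^-1) _ := is_deriveV (f := id) p1 (is_derive_id p 1).
by apply: is_derive_eq; rewrite /GRing.scale/=; field.
Qed.

Let is_derive_rest (d : R) p : 0 < p ->
  is_derive p 1 (fun t => d / t ^+ 3) (- (3 * d / p ^+ 4)).
Proof.
move=> p0; have p1 : p ^+ 3 != 0 by rewrite expf_neq0 // gt_eqF.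
apply: is_derive_eq; rewrite /GRing.scale/=; field.
by rewrite gt_eqF.
Qed.

Lemma binE_ln_ge N p : 0 < p <= 1 -> 20 <= N%:R * p ->
  ln ((N%:R + a) * p) + c / (N%:R + 1) * (p^-1 - 1) <=
  binE N p (fun x => ln (x%:R + a)).
Proof.
case: N => [_|N]; first by rewrite mul0r; lra.
move=> p01 Np; have /andP[p0 p1] := p01; have /andP[a1 a2] := @alpha_hat_bounds R.
have : F N.+1 1 - F N.+1 p <=
    (ln 1 + (c / (N.+1%:R + 1)) / 1) - (ln p + (c / (N.+1%:R + 1)) / p).
  apply: (@le_of_derive_le _ _ (fun t => ln t + (c / (N.+1%:R + 1)) / t) (dF N)
    (fun t => t^-1 - (c / (N.+1%:R + 1)) / t ^+ 2)) => // t /andP[pt t1].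
    by apply: is_derive_main; exact: lt_le_trans pt.
  have t0 : 0 < t by exact: lt_le_trans pt.
  have := @dF_le N t; rewrite t0 t1 => /(_ isT); rewrite natr1 -mulrA -invfM; apply.
  by apply: le_trans Np _; rewrite ler_pM2l// ltr0n.
have Na : 0 < N.+1%:R + a by rewrite ltr_wpDl//; lra.
rewrite /F binE1 ln1 lnM ?posrE//.
by rewrite divr1; move: (binE _ _ _) (ln _) (ln p) p^-1 (c / _) => f u v w z; lra.
Qed.

(** The remainder [11 / (N^3 t^4)] of [dF_ge] integrates over [[p, 1]] to [(11/3) (p^-3 - 1) / N^3];
    the 4 is 11/3 rounded up. *)
Lemma binE_ln_le N p : (0 < N)%N -> 0 < p <= 1 ->
  binE N p (fun x => ln (x%:R + a)) <=
  ln ((N%:R + a) * p) + c / (N%:R + 1) * (p^-1 - 1) + 4 / (N%:R * p) ^+ 3.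
Proof.
case: N => [//|N] _.
move=> p01; have /andP[p0 p1] := p01; have /andP[a1 a2] := @alpha_hat_bounds R.
pose G t := (ln t + (c / (N.+1%:R + 1)) / t) + (11 / 3 / N.+1%:R ^+ 3) / t ^+ 3.
have N0 : N.+1%:R != 0 :> R by rewrite pnatr_eq0.
have : G 1 - G p <= F N.+1 1 - F N.+1 p.
  apply: (@le_of_derive_le _ _ _ (fun t => (t^-1 - (c / (N.+1%:R + 1)) / t ^+ 2) +
     - (3 * (11 / 3 / N.+1%:R ^+ 3) / t ^+ 4)) (dF N)) => // t /andP[pt t1];
    have t0 : 0 < t by exact: lt_le_trans pt.
    have := is_derive_main (c / (N.+1%:R + 1)) t0.
    have := is_derive_rest (11 / 3 / N.+1%:R ^+ 3) t0.
    by move=> ? ?; apply: is_deriveD.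
  have := @dF_ge N t; rewrite t0 t1 => /(_ isT); rewrite natr1 -(mulrA c) -invfM.
  rewrite (_ : 3 * _ / _ = 11 / (N.+1%:R ^+ 3 * t ^+ 4)) //.
  by field; rewrite gt_eqF//= addrC natr1.
have Na : 0 < N.+1%:R + a by rewrite ltr_wpDl//; lra.
rewrite /F /G binE1 ln1 lnM ?posrE//.
have p3 : 1 <= p ^- 3 by rewrite -invr1 lef_pV2 ?posrE ?exprn_gt0// exprn_ile1// ltW.
have N3 : 0 < N.+1%:R ^- 3 :> R by rewrite invr_gt0 exprn_gt0.
have n3 : 0 <= N.+1%:R ^- 3 * p ^- 3 by rewrite mulr_ge0 ?ltW// (lt_le_trans _ p3).
rewrite divr1 expr1n divr1 exprMn (invfM (_ ^+ 3)).
by move: (binE _ _ _) (ln _) (ln p) p^-1 (c / _) (p ^- 3) (_ ^- 3) p3 N3 n3 => f u v w z y x *; lra.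
Qed.

End BinomialLog.

(** * Count vectors and the addition of one observation *)

Section Counts.
Context {k : nat}.
Implicit Types (f : {ffun 'I_k -> nat}) (i j : 'I_k).

(** Entries in [nat] have a type independent of the sample size, so vectors for [n] and [n + 1]
    observations can be compared. *)
Definition count_vec n (x : counts k n) : {ffun 'I_k -> nat} :=
  [ffun i => nat_of_ord (val x i)].

Lemma count_vec_inj n : injective (@count_vec n).
Proof.
move=> x y /ffunP e; apply/val_inj/ffunP => i; apply: val_inj.
by have := e i; rewrite !ffunE.
Qed.

Lemma sum_count_vec n (x : counts k n) : (\sum_i count_vec x i)%N = n.
Proof. by under eq_bigr do rewrite ffunE; apply/eqP; exact: (valP x). Qed.

Lemma counts_of_subproof n f (e : (\sum_i f i)%N = n) :
  (\sum_i [ffun i => inord (f i) : 'I_n.+1] i)%N == n.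
Proof.
rewrite -[X in _ == X]e; apply/eqP/eq_bigr => i _; rewrite ffunE inordK// ltnS -e.
by rewrite (bigD1 i)//= leq_addr.
Qed.

Definition counts_of n f (e : (\sum_i f i)%N = n) : counts k n :=
  exist (fun x : {ffun 'I_k -> 'I_n.+1} => (\sum_i x i)%N == n) _
    (counts_of_subproof e).

Lemma counts_ofK n f (e : (\sum_i f i)%N = n) : count_vec (counts_of e) = f.
Proof.
apply/ffunP => i; rewrite !ffunE/= inordK// ltnS -e.
by rewrite (bigD1 i)//= leq_addr.
Qed.

Definition incr f i : {ffun 'I_k -> nat} := [ffun j => (f j + (j == i))%N].

Lemma sum_incr f i : (\sum_j incr f i j)%N = (\sum_j f j).+1.
Proof.
under eq_bigr do rewrite ffunE.
rewrite big_split/= (_ : \sum_(j < k) (j == i) = 1)%N ?addn1//.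
by rewrite (bigD1 i)//= eqxx big1 ?addn0// => j /negbTE ->.
Qed.

Lemma sum_incr_counts n (x : counts k n) i :
  (\sum_j incr (count_vec x) i j)%N = n.+1.
Proof. by rewrite sum_incr sum_count_vec. Qed.

Definition add_obs n i (x : counts k n) : counts k n.+1 :=
  counts_of (sum_incr_counts x i).

Lemma add_obs_inj n i : injective (@add_obs n i).
Proof.
move=> x y /(congr1 (@count_vec _)); rewrite !counts_ofK => /ffunP e.
by apply/count_vec_inj/ffunP => j; have := e j; rewrite !ffunE => /addIn.
Qed.

Lemma add_obs_surj n i (x : counts k n.+1) : (0 < count_vec x i)%N ->
  exists y, x = add_obs i y.
Proof.
move=> xi; pose f := [ffun j => (count_vec x j - (j == i))%N].
have fx : incr f i = count_vec x.
  apply/ffunP => j; rewrite 2!ffunE subnK//.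
  by case: eqP => // ->.
have fn : (\sum_j f j)%N = n.
  by apply: succn_inj; rewrite -(sum_incr f i) fx sum_count_vec.
exists (counts_of fn); apply: count_vec_inj.
by rewrite counts_ofK -fx counts_ofK.
Qed.

(** Vectors with a positive entry at [i] are exactly the images of the injective [add_obs i], and
    the others contribute 0. *)
Lemma sum_add_obs {R : realType} n i (F : counts k n.+1 -> R) :
  (forall x, count_vec x i = 0%N -> F x = 0) ->
  \sum_x F x = \sum_(x : counts k n) F (add_obs i x).
Proof.
move=> F0; rewrite (bigID (fun x => x \in imset (@add_obs n i) (mem predT)))/=.
rewrite [X in _ + X]big1 ?addr0; last first.
  move=> x; have [/F0//|xi] := posnP (count_vec x i).
  by move=> /negP[]; have [y ->] := add_obs_surj xi; apply/imsetP; exists y.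
by rewrite big_imset/=; [apply: eq_bigl => x; rewrite inE|move=> x y _ _ /add_obs_inj].
Qed.

Definition single i : {ffun 'I_k -> nat} := [ffun j => nat_of_bool (j == i)].

Lemma sum_single i : (\sum_j single i j)%N = 1.
Proof.
rewrite (bigD1 i)//= ffunE eqxx big1 ?addn0// => j.
by rewrite ffunE => /negbTE ->.
Qed.

Definition obs i : counts k 1 := counts_of (sum_single i).

Lemma obs_bij : bijective obs.
Proof.
have obsinj : injective obs.
  move=> i j /(congr1 (@count_vec _)); rewrite !counts_ofK => /ffunP/(_ i).
  by rewrite !ffunE eqxx; case: eqP.
have obssurj y : exists i, obs i == y.
  have [i yi] : exists i, (0 < count_vec y i)%N.
    apply/existsP; apply: contraT; rewrite negb_exists => /forallP y0.
    have := sum_count_vec y; rewrite big1// => i _.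
    by apply/eqP; rewrite -leqn0 leqNgt; exact: y0.
  exists i; have [z ->] := add_obs_surj yi; apply/eqP/count_vec_inj/ffunP => j.
  rewrite !counts_ofK !ffunE; suff -> : nat_of_ord (val z j) = 0%N by [].
  have := ltn_ord (val z j); have := sum_count_vec z.
  move=> /eqP; rewrite sum_nat_eq0 => /forallP/(_ j)/=.
  by rewrite ffunE => /eqP.
by exists (fun y => xchoose (obssurj y)) => [i|y]; [apply: obsinj|];
  apply/eqP; exact: (xchooseP (obssurj _)).
Qed.

End Counts.

(** * Multinomial expectations and their binomial marginals *)

Section Multinomial.
Context {R : realType} {k : nat}.
Implicit Types (theta : k.-1.-tuple R) (f : {ffun 'I_k -> nat}).

Lemma multinomial_pmfE n theta (x : counts k n) : multinomial_pmf theta x =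
  n`!%:R / \prod_i (count_vec x i)`!%:R * \prod_i coord theta i ^+ count_vec x i.
Proof.
rewrite /multinomial_pmf; congr (_ / _ * _).
  by apply: eq_bigr => i _; rewrite ffunE.
by apply: eq_bigr => i _; rewrite ffunE.
Qed.

(** The multinomial counterpart of [binE_stein], pointwise; it is what allows one observation to be
    removed in [multES]. *)
Lemma multinomial_pmf_add_obs n theta (x : counts k n) i :
  multinomial_pmf theta (add_obs i x) * (count_vec (add_obs i x) i)%:R =
  n.+1%:R * (coord theta i * multinomial_pmf theta x).
Proof.
rewrite !multinomial_pmfE !counts_ofK.
rewrite (bigD1 i)//= [X in _ / _ * X](bigD1 i)//=.
rewrite [X in _ = _ * (_ * (_ / X * _))](bigD1 i)//= [X in _ = _ * (_ * (_ / _ * X))](bigD1 i)//=.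
under eq_bigr => j /negbTE ji do rewrite ffunE ji addn0.
under [X in _ * (_ * X) * _]eq_bigr => j /negbTE ji do rewrite ffunE ji addn0.
rewrite !ffunE eqxx addn1 !factS !natrM exprS.
have fn0 m : m`!%:R != 0 :> R by rewrite pnatr_eq0 -lt0n fact_gt0.
have pn0 : \prod_(j < k | j != i) (count_vec x j)`!%:R != 0 :> R by apply/prodf_neq0.
field; rewrite pn0 fn0/= addrC natr1 pnatr_eq0//.
Qed.

Definition multE n theta (G : {ffun 'I_k -> nat} -> R) : R :=
  \sum_(x : counts k n) multinomial_pmf theta x * G (count_vec x).

Lemma multES n theta G :
  multE n.+1 theta G = \sum_i coord theta i * multE n theta (fun f => G (incr f i)).
Proof.
have n0 : n.+1%:R != 0 :> R by rewrite pnatr_eq0.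
apply: (mulfI n0); rewrite /multE mulr_sumr.
(* The factor [n + 1] is spread as the sum of the entries of [x]; each term then vanishes when its
   entry is 0 and can be reindexed by [add_obs i]. *)
transitivity (\sum_(x : counts k n.+1) \sum_i
    (multinomial_pmf theta x * (count_vec x i)%:R) * G (count_vec x)).
  apply: eq_bigr => x _; rewrite -mulr_suml -mulr_sumr -natr_sum sum_count_vec; ring.
rewrite exchange_big/= mulr_sumr; apply: eq_bigr => i _.
rewrite (@sum_add_obs _ _ _ i) => [|x ->]; last by rewrite mulr0 mul0r.
rewrite !mulr_sumr; apply: eq_bigr => x _.
by rewrite multinomial_pmf_add_obs counts_ofK; ring.
Qed.

Lemma coord_last (n : nat) (theta : n.+1.-1.-tuple R) :
  coord theta ord_max = 1 - \sum_(t <- theta) t.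
Proof. by rewrite /coord nth_default//= size_tuple. Qed.

Lemma coord_widen (n : nat) (theta : n.+1.-1.-tuple R) (i : 'I_n) :
  coord theta (widen_ord (leqnSn n) i) = tnth theta i.
Proof. by rewrite /coord (tnth_nth (1 - \sum_(t <- theta) t)). Qed.

Lemma sum_coord theta : (0 < k)%N -> \sum_i coord theta i = 1.
Proof.
case: k theta => // n theta _; rewrite big_ord_recr/= coord_last [X in _ + (1 - X)]big_tuple.
under eq_bigr do rewrite coord_widen.
by rewrite addrC subrK.
Qed.

Lemma multE0 theta (G : {ffun 'I_k -> nat} -> R) : multE 0 theta G = G [ffun=> 0%N].
Proof.
have s0 : (\sum_(i < k) [ffun=> 0%N] i)%N = 0%N by rewrite big1// => i _; rewrite ffunE.
rewrite /multE (bigD1 (counts_of s0))//= big1 ?addr0 => [|x].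
  rewrite multinomial_pmfE counts_ofK !big1 ?mulr1 ?divr1 ?mul1r// => i _.
    by rewrite ffunE expr0.
  by rewrite ffunE fact0.
move=> /negP[]; apply/eqP/count_vec_inj/ffunP => i; rewrite counts_ofK !ffunE.
by case: (val x i) => -[].
Qed.

(** In [multES] an observation in a class other than [i] leaves [f i] unchanged, and these classes
    have total probability [1 - coord theta i]; what remains is the recursion of [binE]. *)
Lemma multE_coord n theta (g : nat -> R) i : (0 < k)%N ->
  multE n theta (fun f => g (f i)) = binE n (coord theta i) g.
Proof.
move=> k0; elim: n g => [|n IH] g; first by rewrite multE0/= ffunE.
rewrite multES (bigD1 i)//= -(IH (g \o S)) -(IH g); congr (_ * _ + _).
  by apply: eq_bigr => x _; rewrite [in RHS]/= -addn1 ffunE eqxx.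
under eq_bigr => j ji.
  rewrite (_ : multE n theta (fun f => g (incr f j i)) = multE n theta (fun f => g (f i))).
    over.
  by apply: eq_bigr => x _; rewrite ffunE eq_sym (negbTE ji) addn0.
rewrite -mulr_suml; congr (_ * _); rewrite -(sum_coord theta k0).
by rewrite [in RHS](bigD1 i)//= addrAC subrr add0r.
Qed.

Lemma multinomial_pmf_obs theta i : multinomial_pmf theta (obs i) = coord theta i.
Proof.
rewrite multinomial_pmfE counts_ofK (bigD1 i)//= [X in _ * X](bigD1 i)//= !ffunE eqxx.
rewrite !big1 => [|j /negbTE ji|j /negbTE ji]; rewrite ?ffunE ?ji ?fact0//.
by rewrite expr1 !mulr1 divff ?mul1r// pnatr_eq0.
Qed.

Lemma sum_multinomial_pmf n theta : (0 < k)%N ->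
  \sum_(x : counts k n) multinomial_pmf theta x = 1.
Proof.
move=> k0; have := @multE_coord n theta (fun=> 1) (Ordinal k0) k0.
by rewrite binE_cst => <-; apply: eq_bigr => x _; rewrite mulr1.
Qed.

Lemma sum_obs (V : nmodType) (F : counts k 1 -> V) : \sum_y F y = \sum_i F (obs i).
Proof. by apply: reindex; apply: onW_bij; exact: obs_bij. Qed.

Lemma multinomial_pmf_ge0 n theta (x : counts k n) :
  Delta k theta -> 0 <= multinomial_pmf theta x.
Proof.
move=> D; rewrite mulr_ge0 ?divr_ge0 ?prodr_ge0// => i _.
by rewrite exprn_ge0//; exact: D.
Qed.

End Multinomial.

(** * The risk of the Dirichlet predictive density *)

Section Risk.
Context {R : realType} {k : nat} (k0 : (0 < k)%N).
Implicit Types (theta : k.-1.-tuple R) (i : 'I_k).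
Local Notation a := (alpha_hat : R).
Local Notation c := (alpha_hat - 1 / 2 : R).

Definition risk_real N theta (q : counts k N -> counts k 1 -> R) : R :=
  \sum_i \sum_(x : counts k N) multinomial_pmf theta x * coord theta i *
    (ln (coord theta i) - ln (q x (obs i))).

Lemma riskE N theta (q : counts k N -> counts k 1 -> R) :
  (forall i, 0 < coord theta i) -> (forall x y, 0 < q x y) ->
  risk theta q = (risk_real theta q)%:E.
Proof.
move=> t0 q0; rewrite /risk /risk_real sum_obs -sumEFin; apply: eq_bigr => i _.
rewrite -sumEFin; apply: eq_bigr => x _.
rewrite multinomial_pmf_obs inver gt_eqF// -EFinM lne_EFin ?divr_gt0//.
by rewrite -EFinM ln_div ?posrE.
Qed.

(** Restricts the minimax problem to strictly positive densities. One term of the sum is [+oo], and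
    the others must be shown different from [-oo]. *)
Lemma risk_pinfty N theta (q : counts k N -> counts k 1 -> R) x y :
  (forall i, 0 < coord theta i) -> (forall x y, 0 <= q x y) -> q x y = 0 ->
  risk theta q = +oo%E.
Proof.
move=> t0 q0 qxy.
have pmf0 n (z : counts k n) : 0 < multinomial_pmf theta z.
  rewrite mulr_gt0 ?divr_gt0 ?prodr_gt0 ?ltr0n ?fact_gt0// => j _.
  by rewrite exprn_gt0.
have term0 x' y' : q x' y' = 0 -> ((multinomial_pmf theta x' * multinomial_pmf theta y')%:E *
    lne ((multinomial_pmf theta y')%:E / (q x' y')%:E) = +oo)%E.
  by move=> ->; rewrite inve0 gt0_muley ?lte_fin//= gt0_muley// lte_fin mulr_gt0.
have termNy x' y' : ((multinomial_pmf theta x' * multinomial_pmf theta y')%:E *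
    lne ((multinomial_pmf theta y')%:E / (q x' y')%:E) != -oo)%E.
  have [/term0->//|qn0] := eqVneq (q x' y') 0.
  have qp : 0 < q x' y' by rewrite lt_neqAle eq_sym qn0 q0.
  by rewrite inver (negbTE qn0) -EFinM lne_EFin ?divr_gt0// -EFinM.
have sumNy y' : (\sum_x' (multinomial_pmf theta x' * multinomial_pmf theta y')%:E *
    lne ((multinomial_pmf theta y')%:E / (q x' y')%:E) != -oo)%E.
  by apply/eqP => /esum_eqNyP[x' [_ _ /eqP]]; rewrite (negbTE (termNy _ _)).
apply/esum_eqyP => [y' _ //|]; exists y; split; rewrite ?mem_index_enum//.
by apply/esum_eqyP => [x' _ //|]; exists x; split; rewrite ?mem_index_enum// term0.
Qed.

Definition dirichlet_pred N (x : counts k N) i : R :=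
  ((count_vec x i)%:R + a) / (N%:R + k%:R * a).

(** The [i]-th log-loss depends on the data only through the [i]-th count, so its expectation is a
    binomial one. *)
Lemma risk_real_dirichlet N theta (q : counts k N -> counts k 1 -> R) :
  (forall x i, q x (obs i) = dirichlet_pred x i) ->
  risk_real theta q = \sum_i coord theta i * (ln (coord theta i) +
    ln (N%:R + k%:R * a) - binE N (coord theta i) (fun x => ln (x%:R + a))).
Proof.
move=> qE; have /andP[a1 _] := @alpha_hat_bounds R.
apply: eq_bigr => i _; rewrite -multE_coord// mulrBr mulr_sumr.
set L := _ * (_ + _); have -> : L = \sum_(x : counts k N) multinomial_pmf theta x * L.
  by rewrite -mulr_suml sum_multinomial_pmf// mul1r.
rewrite -sumrB {}/L.
apply: eq_bigr => x _; rewrite qE ln_div ?posrE; first by ring.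
  by rewrite ltr_wpDl//; lra.
by rewrite ltr_wpDl// mulr_gt0 ?ltr0n//; lra.
Qed.

Lemma coord_le1 theta i : Delta k theta -> coord theta i <= 1.
Proof.
move=> D; rewrite -(sum_coord theta k0) (bigD1 i)//= lerDl sumr_ge0//.
Qed.

(** The constant [U_N] of the overview; [k - 1] is the sum of [theta_i (1 / theta_i - 1)]. *)
Definition risk_main N : R :=
  ln (N%:R + k%:R * a) - ln (N%:R + a) - c * (k%:R - 1) / (N%:R + 1).

Let sum_main N theta : (forall i, 0 < coord theta i) ->
  risk_main N = \sum_i coord theta i * (ln (coord theta i) +
    ln (N%:R + k%:R * a) - (ln ((N%:R + a) * coord theta i) +
       c / (N%:R + 1) * ((coord theta i)^-1 - 1))).
Proof.
move=> t0; have /andP[a1 _] := @alpha_hat_bounds R.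
have Na : 0 < N%:R + a by rewrite ltr_wpDl//; lra.
transitivity (\sum_i (coord theta i * (ln (N%:R + k%:R * a) - ln (N%:R + a) + c / (N%:R + 1)) -
   c / (N%:R + 1))); last first.
  apply: eq_bigr => i _; rewrite lnM ?posrE//.
  set d := c / _; have ti := t0 i; clearbody d; field; exact: lt0r_neq0.
rewrite sumrB -mulr_suml sum_coord// sumr_const card_ord /risk_main -mulr_natr.
by move: (_ + 1)^-1 => z; ring.
Qed.

Lemma risk_dirichlet_le N theta (q : counts k N -> counts k 1 -> R) :
  (forall x i, q x (obs i) = dirichlet_pred x i) ->
  Delta k theta -> (forall i, 0 < coord theta i) ->
  (forall i, 20 <= N%:R * coord theta i) ->
  risk_real theta q <= risk_main N.
Proof.
move=> qE D t0 Nt; rewrite (risk_real_dirichlet _ qE) (sum_main N t0).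
apply: ler_sum => i _; rewrite ler_wpM2l ?(ltW (t0 i))// lerB//.
by rewrite binE_ln_ge// t0 coord_le1.
Qed.

Lemma risk_dirichlet_ge N theta (q : counts k N -> counts k 1 -> R) :
  (forall x i, q x (obs i) = dirichlet_pred x i) -> (0 < N)%N ->
  Delta k theta -> (forall i, 0 < coord theta i) ->
  risk_main N - \sum_i 4 / (N%:R ^+ 3 * coord theta i ^+ 2) <= risk_real theta q.
Proof.
move=> qE N0 D t0; rewrite (risk_real_dirichlet _ qE) (sum_main N t0) -sumrB.
apply: ler_sum => i _.
have ti : 0 < coord theta i <= 1 by rewrite t0 coord_le1.
have := binE_ln_le N0 ti; have /andP[ti0 ti1] := ti.
have -> : 4 / (N%:R ^+ 3 * coord theta i ^+ 2) = coord theta i * (4 / (N%:R * coord theta i) ^+ 3).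
  by field; rewrite gt_eqF//= pnatr_eq0; lia.
rewrite -mulrBr => h; rewrite ler_pM2l//; move: h.
by move: (4 / _) (c / _ * _) (binE _ _ _) (ln _) (ln _) => *; lra.
Qed.

End Risk.

(** * Beta integrals and their recursion *)

Section BetaIntegral.
Context {R : realType}.
Local Notation mu := (@lebesgue_measure R).
Implicit Types (e f s t : R).

(** For [e > 0] this vanishes on negative [t]. The simplex constraint is thus carried by the
    integrand, and integrals run over the whole space. *)
Definition pow_pos e t : R := Num.max 0 t `^ e.

Lemma pow_pos_ge0 e t : 0 <= pow_pos e t.
Proof. exact: powR_ge0. Qed.

Lemma pow_posE e t : 0 <= t -> pow_pos e t = t `^ e.
Proof. by move=> t0; rewrite /pow_pos max_r. Qed.

Lemma pow_pos_le0 e t : 0 < e -> t <= 0 -> pow_pos e t = 0.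
Proof. by move=> e0 t0; rewrite /pow_pos max_l// powR0// gt_eqF. Qed.

Lemma pow_pos_le1 e t : 0 < e -> t <= 1 -> pow_pos e t <= 1.
Proof.
move=> e0 t1; apply: (@le_trans _ _ (1 `^ e)); last by rewrite powR1.
rewrite /pow_pos ge0_ler_powR ?nnegrE ?(ltW e0) ?le_max ?lexx// ge_max.
by rewrite ler01.
Qed.

Lemma le_pow_pos e s t : 0 < e -> s <= t -> pow_pos e s <= pow_pos e t.
Proof.
move=> e0 st; have m : Num.max 0 s <= Num.max 0 t.
  by rewrite ge_max !le_max lexx/= st orbT.
have n0 u : 0 <= Num.max (0 : R) u by rewrite le_max lexx.
by apply: ge0_ler_powR; rewrite ?nnegrE// ltW.
Qed.

Lemma pow_posD1 e t : 0 < e -> 0 <= t -> pow_pos (e + 1) t = t * pow_pos e t.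
Proof.
move=> e0 t0; rewrite !pow_posE// powRD ?powRr1 1?mulrC//.
by apply/implyP => /eqP; lra.
Qed.

Lemma pow_posM e s t : 0 <= s -> pow_pos e (s * t) = s `^ e * pow_pos e t.
Proof.
move=> s0; rewrite /pow_pos -powRM// ?le_max ?lexx//.
by rewrite maxr_pMr// mulr0.
Qed.

Lemma continuous_pow_pos e : 0 < e -> continuous (pow_pos e).
Proof.
move=> e0 t; have [t0|t0] := ltP 0 t.
  have ct : {for t, continuous (@powR R ^~ e)}.
    apply/differentiable_continuous/derivable1_diffP/derivable_powR.
    by rewrite in_itv/= t0.
  rewrite /continuous_at (pow_posE _ (ltW t0)).
  apply: cvg_trans ct; apply: near_eq_cvg.
  by near=> u; rewrite pow_posE// ltW//; near: u; exact: lt_nbhsr.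
apply/cvgrPdist_le => d d0; rewrite (pow_pos_le0 e0 t0).
near=> u; rewrite sub0r normrN ger0_norm ?pow_pos_ge0//.
have : u <= d `^ e^-1.
  near: u; apply: filterS (nbhsx_ballx t _ (_ : 0 < d `^ e^-1)) => [u|]; last exact: powR_gt0.
  by rewrite /ball/= ltr_norml => /andP[]; lra.
move=> /(le_pow_pos e0)/le_trans; apply.
by rewrite pow_posE ?powR_ge0// -powRrM mulVf ?lt0r_neq0// powRr1// ltW.
Unshelve. all: by end_near. Qed.

Let G e f s t := pow_pos e t * pow_pos f (s - t).

Let cG e f s : 0 < e -> 0 < f -> continuous (G e f s).
Proof.
move=> e0 f0 t; apply: cvgM; first exact: continuous_pow_pos.
apply: (@cvg_comp _ _ _ (fun u => s - u) (pow_pos f)); last exact: continuous_pow_pos.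
by apply: cvgB; [exact: cvg_cst|exact: cvg_id].
Qed.

Lemma measurable_pow_pos e : 0 < e -> measurable_fun setT (pow_pos e).
Proof. by move=> e0; exact: continuous_measurable_fun (continuous_pow_pos e0). Qed.

Let mG e f s (D : set R) : 0 < e -> 0 < f ->
  measurable_fun D (fun t => (G e f s t)%:E).
Proof.
move=> e0 f0; apply: measurable_funTS; apply/measurable_EFinP.
by have /continuous_measurable_fun := @cG e f s e0 f0.
Qed.

Let G_ge0 e f s t : 0 <= G e f s t.
Proof. by rewrite mulr_ge0// pow_pos_ge0. Qed.

(** Euler's [B(e + 1, f + 1)]: the arguments are the exponents. *)
Definition beta_int e f : R := (\int[mu]_(t in `[0%R, 1%R]) (pow_pos e t * pow_pos f (1 - t)))%R.

Let iG e f : 0 < e -> 0 < f -> mu.-integrable `[0%R, 1%R] (EFin \o G e f 1).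
Proof.
move=> e0 f0; apply: continuous_compact_integrable; first exact: segment_compact.
exact/continuous_subspaceT/cG.
Qed.

Let beta_intE e f : 0 < e -> 0 < f ->
  (\int[mu]_t (pow_pos e t * pow_pos f (1 - t))%:E = (beta_int e f)%:E)%E.
Proof.
move=> e0 f0; rewrite /beta_int /Rintegral fineK; last first.
  exact: integrable_fin_num (iG e0 f0).
rewrite [RHS]integral_mkcond; apply: eq_integral => t _; rewrite patchE.
case: ifPn => //; rewrite notin_setE/= in_itv/= => /negP.
rewrite negb_and -!ltNge => /orP[t0|t1].
  by rewrite pow_pos_le0 ?mul0r// ltW.
by rewrite [X in _ * X]pow_pos_le0 ?mulr0//; lra.
Qed.

(** Integrates out one coordinate of a Dirichlet density. For [s > 0] the substitution [t = s u]
    extracts [s^(e + f + 1)]; for [s <= 0] one of the two factors is always 0. *)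
Lemma pow_pos_conv e f s : 0 < e -> 0 < f ->
  (\int[mu]_t (pow_pos e t * pow_pos f (s - t))%:E =
   (beta_int e f * pow_pos (e + f + 1) s)%:E)%E.
Proof.
move=> e0 f0; have [s0|s0] := leP s 0.
  rewrite pow_pos_le0 ?addr_gt0// mulr0 integral0_eq// => t _.
  have [t0|t0] := leP t 0; first by rewrite pow_pos_le0 ?mul0r.
  by rewrite [X in _ * X]pow_pos_le0 ?mulr0//; lra.
have dF : (fun x : R => s * x)^`()%classic = cst s.
  by apply/funext => x; rewrite derive1E derive_val/= /GRing.scale/= mulr1.
rewrite (@increasing_ge0_integration_by_substitutionT R (fun x => s * x)) ?dF; first last.
- by move=> x; exact: G_ge0.
- exact: cG.
- by apply: gt0_cvgMry => //; exact: cvg_id.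
- by apply: gt0_cvgMrNy => //; exact: cvg_id.
- by move=> x.
- exact: is_cvg_cst.
- exact: is_cvg_cst.
- by move=> x; exact: cvg_cst.
- by move=> x y xy; rewrite ltr_pM2l.
transitivity (\int[mu]_t ((pow_pos (e + f + 1) s)%:E * (pow_pos e t * pow_pos f (1 - t))%:E))%E.
  apply: eq_integral => t _; rewrite -EFinM; congr EFin.
  rewrite fctE/=; have -> : s - s * t = s * (1 - t) by ring.
  rewrite !pow_posM ?(ltW s0)// (pow_posE _ (ltW s0)).
  have sn0 x y : (x + y == 0) ==> (s != 0) by rewrite (gt_eqF s0) implybT.
  by rewrite !powRD ?sn0// (powRr1 (ltW s0)); ring.
rewrite ge0_integralZl//.
- by rewrite beta_intE// -EFinM mulrC.
- exact: mG.
- by move=> t _; rewrite lee_fin; exact: G_ge0.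
- by rewrite lee_fin pow_pos_ge0.
Qed.

Lemma beta_intD e f : 0 < e -> 0 < f ->
  beta_int (e + 1) f + beta_int e (f + 1) = beta_int e f.
Proof.
move=> e0 f0; rewrite /beta_int -RintegralD//=; last 2 first.
- by apply: iG => //; lra.
- by apply: iG => //; lra.
apply: eq_Rintegral => t; rewrite inE/= in_itv/= => /andP[t0 t1].
by rewrite !pow_posD1 ?subr_ge0//; ring.
Qed.

(** The function [t^(e+1) (1 - t)^(f+1)] vanishes at 0 and 1, so its derivative integrates to 0.
    With [beta_intD], which is [t + (1 - t) = 1], this is a linear system whose solution is
    [beta_intSl] and [beta_intSr]. *)
Lemma beta_int_parts e f : 0 < e -> 0 < f ->
  (e + 1) * beta_int e (f + 1) = (f + 1) * beta_int (e + 1) f.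
Proof.
move=> e0 f0.
pose F (t : R) := pow_pos (e + 1) t * pow_pos (f + 1) (1 - t).
pose F' t := (e + 1) * G e (f + 1) 1 t - (f + 1) * G (e + 1) f 1 t.
have e10 : 0 < e + 1 by lra.
have f10 : 0 < f + 1 by lra.
have cF : continuous F by exact: cG.
have i1 := iG e0 f10; have i2 := iG e10 f0.
have dF t : 0 < t < 1 -> is_derive t 1 F (F' t).
  move=> /andP[t0 t1].
  have d1 : is_derive t 1 (pow_pos (e + 1)) ((e + 1) * pow_pos e t).
    apply: (@near_eq_is_derive _ _ _ (@powR R ^~ (e + 1))).
      by near=> u; rewrite pow_posE// ltW//; near: u; exact: lt_nbhsr.
    by rewrite pow_posE ?ltW//; have := is_derive1_powR (e + 1) t0; rewrite addrK.
  have d2 : is_derive t 1 (fun t => pow_pos (f + 1) (1 - t)) (- ((f + 1) * pow_pos f (1 - t))).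
    apply: (@near_eq_is_derive _ _ _ (fun t => (1 - t) `^ (f + 1))).
      by near=> u; rewrite pow_posE// subr_ge0 ltW//; near: u; exact: lt_nbhsl.
    have t10 : 0 < 1 - t by lra.
    rewrite pow_posE ?ltW//; have := is_derive1_powR (f + 1) t10; rewrite addrK => d.
    apply: (@is_derive_eq _ _ _ _ _ _ _ _ (is_derive1_comp _ _)).
    by rewrite /GRing.scale/=; ring.
  have := is_deriveM d1 d2.
  by move=> d; apply: is_derive_eq; rewrite /F' /G /GRing.scale/=; ring.
have : (\int[mu]_(t in `[0%R, 1%R]) (F' t)%:E = (F 1)%:E - (F 0)%:E)%E.
  apply: continuous_FTC2 ltr01 _ _ _.
  - apply: continuous_subspaceT => t; apply: cvgB; apply: cvgM; (exact: cvg_cst || exact: cG).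
  - split=> [t||].
    + by rewrite in_itv/= => /dF[].
    + exact/cvg_at_right_filter/cF.
    + exact/cvg_at_left_filter/cF.
  - by move=> t; rewrite in_itv/= derive1E => /dF[_ ->].
have F1 : F 1 = 0 by rewrite /F subrr [X in _ * X]pow_pos_le0// mulr0.
have F0 : F 0 = 0 by rewrite /F pow_pos_le0// mul0r.
have F10 : ((F 1)%:E - (F 0)%:E = 0)%E by rewrite F1 F0 subee.
move=> ftc; have int0 := etrans ftc F10.
have m01 : measurable (`[0%R, 1%R]%classic : set (measurableTypeR R)) by exact: measurable_itv.
have ie1 : mu.-integrable `[0%R, 1%R] (EFin \o (fun t => (e + 1) * G e (f + 1) 1 t)).
  exact: (@integrableZl _ _ _ mu _ m01 (e + 1) _ i1).
have ie2 : mu.-integrable `[0%R, 1%R] (EFin \o (fun t => (f + 1) * G (e + 1) f 1 t)).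
  exact: (@integrableZl _ _ _ mu _ m01 (f + 1) _ i2).
have := RintegralB m01 ie1 ie2.
rewrite (RintegralZl (e + 1) m01 i1) (RintegralZl (f + 1) m01 i2).
move=> /esym/eqP; rewrite [X in _ == X](_ : _ = 0); last by rewrite /Rintegral int0.
by rewrite subr_eq0 => /eqP.
Unshelve. all: by end_near. Qed.

Lemma beta_intSl e f : 0 < e -> 0 < f ->
  (e + f + 2) * beta_int (e + 1) f = (e + 1) * beta_int e f.
Proof.
move=> e0 f0; have := beta_int_parts e0 f0; rewrite -(beta_intD e0 f0).
move: (beta_int _ (f + 1)) (beta_int (e + 1) f) => *; lra.
Qed.

Lemma beta_intSr e f : 0 < e -> 0 < f ->
  (e + f + 2) * beta_int e (f + 1) = (f + 1) * beta_int e f.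
Proof.
move=> e0 f0; have := beta_int_parts e0 f0; rewrite -(beta_intD e0 f0).
move: (beta_int _ (f + 1)) (beta_int (e + 1) f) => *; lra.
Qed.

Lemma beta_int_gt0 e f : 0 < e -> 0 < f -> 0 < beta_int e f.
Proof.
move=> e0 f0; rewrite -lte_fin -beta_intE//.
(* On [[1/4, 1/2]] both [t] and [1 - t] are at least 1/4. *)
pose m : R := 4^-1 `^ e * 4^-1 `^ f.
have m0 : 0 < m by rewrite mulr_gt0// powR_gt0.
apply: (@lt_le_trans _ _ (\int[mu]_(t in `[4^-1%R, 2^-1%R]) m%:E)%E).
  rewrite integral_cst//= lebesgue_measure_itv/= lte_fin ifT; last by lra.
  by rewrite -EFinD -EFinM lte_fin mulr_gt0//; lra.
apply: (@le_trans _ _ (\int[mu]_(t in `[4^-1%R, 2^-1%R]) (G e f 1 t)%:E)%E).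
  apply: ge0_le_integral => //.
  - by move=> t _; rewrite lee_fin ltW.
  - exact: mG.
  - move=> t /=; rewrite in_itv/= => /andP[t1 t2]; rewrite lee_fin.
    have q0 : 0 <= 4^-1 :> R by rewrite invr_ge0.
    by apply: ler_pM; rewrite ?powR_ge0// -pow_posE// le_pow_pos//; lra.
apply: ge0_subset_integral => //.
- exact: mG.
- by move=> t _; rewrite lee_fin G_ge0.
Qed.

End BetaIntegral.

(** * Iterated integration of products over tuples *)

Section TupleIntegral.
Context {R : realType}.
Local Notation mu := (@lebesgue_measure R).

Lemma lebesgue_measure_reflect (s : R) (A : set R) : measurable A ->
  pushforward mu ((fun t => s - t) : _ -> measurableTypeR R) A = mu A.
Proof.
move=> mA; apply/esym.
have mf : measurable_fun setT ((fun t => s - t) : measurableTypeR R -> measurableTypeR R).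
  exact: measurable_funB.
pose mf' := isMeasurableFun.Build _ _ _ _ _ mf.
pose f : {mfun measurableTypeR R >-> measurableTypeR R} := HB.pack (fun t : R => s - t) mf'.
apply: (@lebesgue_measure_unique R (pushforward mu f)) => //= _ [[a b]] _ <-.
rewrite /pushforward /= (_ : _ @^-1` _ = `[s - b, s - a[%classic); last first.
  by apply/seteqP; split=> t /=; rewrite !in_itv/= => /andP[? ?]; apply/andP; split; lra.
rewrite !lebesgue_measure_itv/= !lte_fin.
by rewrite ltrD2l ltrN2; case: ifP => // _; rewrite -!EFinB; congr EFin; ring.
Qed.

Lemma ge0_integral_reflect (s : R) (h : R -> \bar R) :
  measurable_fun setT h -> (forall t, (0 <= h t)%E) ->
  (\int[mu]_t h (s - t)%R = \int[mu]_t h t)%E.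
Proof.
move=> mh h0.
have mf : measurable_fun setT ((fun t => s - t) : measurableTypeR R -> measurableTypeR R).
  exact: measurable_funB.
have := @ge0_integral_pushforward _ _ _ _ R _ mf mu setT h measurableT mh (fun t _ => h0 t).
rewrite preimage_setT => <-.
by apply: eq_measure_integral => //= A mA _; exact: lebesgue_measure_reflect.
Qed.

Lemma ge0_integral_lebesgue_tupleS n (F : n.+1.-tuple R -> \bar R) :
  measurable_fun setT F -> (forall v, (0 <= F v)%E) ->
  (\int[lebesgue_tuple R n.+1]_v F v =
   \int[mu]_t \int[lebesgue_tuple R n]_v F (tcons (t, v)))%E.
Proof.
move=> mF F0 /=.
have := @ge0_integral_pushforward _ _ _ _ R _ (@measurable_tcons R n)
  (mu \x lebesgue_tuple R n)%E setT F measurableT mF (fun t _ => F0 t).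
rewrite preimage_setT => e; rewrite [LHS]e.
rewrite fubini_tonelli1//; last by move=> x; exact: F0.
exact: measurableT_comp mF (@measurable_tcons R n).
Qed.

Implicit Types (g : nat -> R -> R) (h : R -> R) (s t : R).

(** A product over all coordinates of a simplex of size [s], with [h] at the dependent last one. The
    size is a parameter because fixing the first entry [t] leaves the same shape with size
    [s - t]. *)
Definition tuple_prod n (g : nat -> R -> R) (h : R -> R) (s : R) (v : n.-tuple R) : R :=
  (\prod_(i < n) g i (tnth v i)) * h (s - \sum_(t <- v) t).

Lemma measurable_sum_tuple n : measurable_fun setT (fun v : n.-tuple R => \sum_(t <- v) t).
Proof.
under eq_fun do rewrite big_tuple.
by apply: measurable_sum => i; exact: measurable_tnth.
Qed.

Lemma measurable_tuple_prod n g h s : (forall i, measurable_fun setT (g i)) ->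
  measurable_fun setT h -> measurable_fun setT (@tuple_prod n g h s).
Proof.
move=> mg mh; apply: measurable_funM.
  by apply: measurable_prod => i _; apply: measurableT_comp (mg _) _; exact: measurable_tnth.
apply: measurableT_comp mh _; apply: measurable_funB => //.
exact: measurable_sum_tuple.
Qed.

Lemma tuple_prod0 g h s v : @tuple_prod 0 g h s v = h s.
Proof. by rewrite /tuple_prod big_ord0 mul1r (tuple0 v) big_nil subr0. Qed.

Lemma tuple_prodS n g h s t (v : n.-tuple R) :
  tuple_prod g h s (tcons (t, v)) = g 0%N t * tuple_prod (g \o S) h (s - t) v.
Proof.
rewrite /tuple_prod /tcons big_ord_recl -mulrA; congr (_ * (_ * _)) => /=.
  by apply: eq_bigr => i _; rewrite tnthS.
by rewrite big_cons opprD addrA.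
Qed.

Lemma tuple_prod_ge0 n g h s v : (forall i t, 0 <= g i t) -> (forall t, 0 <= h t) ->
  0 <= @tuple_prod n g h s v.
Proof. by move=> g0 h0; rewrite mulr_ge0// prodr_ge0. Qed.

Lemma integral_tuple_prod0 g h s :
  (\int[lebesgue_tuple R 0]_v (tuple_prod g h s v)%:E = (h s)%:E)%E.
Proof.
rewrite /= integral_dirac//; last first.
  rewrite (_ : (fun v => _) = cst (h s)%:E)//.
  by apply/funext => v; rewrite tuple_prod0.
by rewrite diracE in_setT mul1e tuple_prod0.
Qed.

Lemma integral_tuple_prodS n g h s : (forall i, measurable_fun setT (g i)) ->
  measurable_fun setT h -> (forall i t, 0 <= g i t) -> (forall t, 0 <= h t) ->
  (\int[lebesgue_tuple R n.+1]_v (tuple_prod g h s v)%:E =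
   \int[mu]_t ((g 0%N t)%:E * \int[lebesgue_tuple R n]_v (tuple_prod (g \o S) h (s - t)%R v)%:E))%E.
Proof.
move=> mg mh g0 h0; rewrite ge0_integral_lebesgue_tupleS; last 2 first.
- by apply/measurable_EFinP; exact: measurable_tuple_prod.
- by move=> v; rewrite lee_fin tuple_prod_ge0.
apply: eq_integral => t _.
rewrite -ge0_integralZl//; last 3 first.
- apply/measurable_EFinP; apply: measurable_tuple_prod => // i; exact: mg.
- by move=> v _; rewrite lee_fin tuple_prod_ge0// => i; exact: g0.
- by rewrite lee_fin.
by apply: eq_integral => v _; rewrite tuple_prodS EFinM.
Qed.

Lemma measurable_integral_tuple_prod n g h s : (forall i, measurable_fun setT (g i)) ->
  measurable_fun setT h -> (forall i t, 0 <= g i t) -> (forall t, 0 <= h t) ->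
  measurable_fun [set: measurableTypeR R]
    (fun t => (\int[lebesgue_tuple R n]_v (tuple_prod g h (s - t)%R v)%:E)%E).
Proof.
(* A constant first factor turns the integrand into a [tuple_prod] in one more variable, so that the
   inner integral is a Tonelli section. *)
move=> mg mh g0 h0; pose g' i := if i is j.+1 then g j else cst 1.
pose f p : \bar R := (tuple_prod g' h s (@tcons R n p))%:E.
have mf : measurable_fun setT f.
  apply/measurable_EFinP; apply: measurableT_comp (@measurable_tcons R n).
  by apply: measurable_tuple_prod => // -[|i]; [exact: measurable_cst|exact: mg].
have f0 p : (0 <= f p)%E by rewrite lee_fin tuple_prod_ge0// => -[|i] t; rewrite /= ?ler01.
have := @measurable_fun_fubini_tonelli_F _ _ _ _ R (lebesgue_tuple R n) f mf f0.
apply: eq_measurable_fun => t _; apply: eq_integral => v _.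
by rewrite /f tuple_prodS mul1r.
Qed.

End TupleIntegral.

(** * Dirichlet integrals and bounds for integrals of products *)

Section DirichletConst.
Context {R : realType}.
Local Notation mu := (@lebesgue_measure R).
Implicit Types (e : nat -> R) (g : nat -> R -> R) (h : R -> R).

Definition dirichlet_sum n e : R := \sum_(i < n.+1) (e i + 1).

(** The Dirichlet normalizing integral with parameters [e i + 1], factored into Beta integrals by
    removing one coordinate at a time. *)
Fixpoint dirichlet_const n e : R :=
  if n is m.+1 then
    beta_int (e 0%N) (dirichlet_sum m (e \o S) - 1) * dirichlet_const m (e \o S)
  else 1.

Lemma dirichlet_sumS n e :
  dirichlet_sum n.+1 e = e 0%N + 1 + dirichlet_sum n (e \o S).
Proof. by rewrite /dirichlet_sum big_ord_recl. Qed.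

Lemma dirichlet_sum_gt1 n e : (forall i, 0 < e i) -> 1 < dirichlet_sum n e.
Proof.
move=> e0; rewrite /dirichlet_sum big_ord_recl; have := e0 0%N.
have : 0 <= \sum_(i < n) (e (lift ord0 i) + 1).
  by apply: sumr_ge0 => i _; have := e0 (lift ord0 i); lra.
by rewrite /=; lra.
Qed.

Lemma dirichlet_const_gt0 n e : (forall i, 0 < e i) -> 0 < dirichlet_const n e.
Proof.
elim: n e => //= n IH e e0; rewrite mulr_gt0//; last by apply: IH => i; exact: e0.
by apply: beta_int_gt0 => //; rewrite subr_gt0 dirichlet_sum_gt1// => i; exact: e0.
Qed.

Lemma dirichlet_const_incr n e j : (forall i, 0 < e i) -> (j <= n)%N ->
  dirichlet_sum n e * dirichlet_const n (fun i => e i + (i == j)%:R) =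
  (e j + 1) * dirichlet_const n e.
Proof.
elim: n e j => [|n IH] e j e0.
  by rewrite leqn0 => /eqP->; rewrite /dirichlet_sum big_ord1.
have es0 i : 0 < (e \o S) i by exact: e0.
have s1 : 0 < dirichlet_sum n (e \o S) - 1 by rewrite subr_gt0 dirichlet_sum_gt1.
(* For index 0 only the first argument of the leading Beta integral changes. Otherwise its second
   argument and the tail both change, and the factor [E] released by [beta_intSr] is the one that
   the induction hypothesis consumes. *)
case: j => [_|j]; rewrite /= dirichlet_sumS.
  have -> : (fun i => e i + (i == 0%N)%:R) \o S = e \o S by apply/funext => i /=; rewrite addr0.
  have := beta_intSl (e0 0%N) s1; set E := dirichlet_sum n _; set C := dirichlet_const _ _.
  move=> b; rewrite mulrA (_ : e 0%N + 1 + E = e 0%N + (E - 1) + 2); last by ring.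
  by rewrite b mulrA.
rewrite ltnS => jn; have {IH} := IH _ _ es0 jn.
rewrite addr0 (_ : (fun i => e i + (i == j.+1)%:R) \o S = (fun i => (e \o S) i + (i == j)%:R))//.
have -> : dirichlet_sum n (fun i => (e \o S) i + (i == j)%:R) = dirichlet_sum n (e \o S) + 1.
  rewrite /dirichlet_sum; under eq_bigr do rewrite addrAC.
  rewrite big_split/=; congr (_ + _).
  have jn' : (j < n.+1)%N by rewrite ltnS.
  rewrite (bigD1 (Ordinal jn'))//= eqxx big1 ?addr0// => i /negbTE ij.
  by rewrite -val_eqE/= in ij; rewrite ij.
have := beta_intSr (e0 0%N) s1; move: s1.
set E := dirichlet_sum n _; set C := dirichlet_const _ _; set D := dirichlet_const _ _.
move=> _; rewrite (addrAC E) (_ : e 0%N + 1 + E = e 0%N + (E - 1) + 2); last by ring.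
move=> b IH; rewrite mulrA b addrK mulrAC IH -mulrA; congr (_ * _).
exact: mulrC.
Qed.

Lemma integral_dirichlet n e s : (forall i, 0 < e i) ->
  (\int[lebesgue_tuple R n]_v (tuple_prod (fun i => pow_pos (e i)) (pow_pos (e n)) s v)%:E =
   (dirichlet_const n e * pow_pos (dirichlet_sum n e - 1) s)%:E)%E.
Proof.
elim: n e s => [|n IH] e s e0.
  by rewrite integral_tuple_prod0 mul1r /dirichlet_sum big_ord1 addrK.
have es0 i : 0 < (e \o S) i by exact: e0.
have s1 : 0 < dirichlet_sum n (e \o S) - 1 by rewrite subr_gt0 dirichlet_sum_gt1.
rewrite integral_tuple_prodS; last 4 first.
- by move=> i; exact: measurable_pow_pos.
- exact: measurable_pow_pos.
- by move=> i t; exact: pow_pos_ge0.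
- by move=> t; exact: pow_pos_ge0.
transitivity (\int[mu]_t ((dirichlet_const n (e \o S))%:E *
    (pow_pos (e 0%N) t * pow_pos (dirichlet_sum n (e \o S) - 1) (s - t))%:E))%E.
  apply: eq_integral => t _; have := IH (e \o S) (s - t) es0; rewrite /= => ->.
  by rewrite -!EFinM; congr EFin; ring.
rewrite ge0_integralZl//.
- rewrite pow_pos_conv// -EFinM dirichlet_sumS /=; congr EFin.
  by rewrite (_ : e 0%N + 1 + _ - 1 = e 0%N + (dirichlet_sum n (e \o S) - 1) + 1); ring.
- apply/measurable_EFinP; apply: measurable_funM; first exact: measurable_pow_pos.
  apply: measurableT_comp; first exact: measurable_pow_pos.
  exact: measurable_funB.
- by move=> t _; rewrite lee_fin mulr_ge0// pow_pos_ge0.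
- by rewrite lee_fin ltW// dirichlet_const_gt0.
Qed.

Lemma integral_tuple_prod_le n g h s M (m : nat -> R) :
  (forall i, measurable_fun setT (g i)) -> measurable_fun setT h ->
  (forall i t, 0 <= g i t) -> (forall t, 0 <= h t <= M) ->
  (forall i, (\int[mu]_t (g i t)%:E <= (m i)%:E)%E) ->
  (\int[lebesgue_tuple R n]_v (tuple_prod g h s v)%:E <= (M * \prod_(i < n) m i)%:E)%E.
Proof.
move=> mg mh g0 h0M; elim: n g s m mg g0 => [|n IH] g s m mg g0 gm.
  by rewrite integral_tuple_prod0 big_ord0 mulr1 lee_fin; case/andP: (h0M s).
have h0 t : 0 <= h t by case/andP: (h0M t).
have M0 : 0 <= M by case/andP: (h0M 0) => /le_trans; apply.
have m0 i : 0 <= m i.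
  by rewrite -lee_fin; apply: le_trans (gm i); apply: integral_ge0 => t _; rewrite lee_fin.
have P0 : 0 <= M * \prod_(i < n) (m \o S) i by rewrite mulr_ge0// prodr_ge0// => i _; exact: m0.
rewrite integral_tuple_prodS//.
apply: (@le_trans _ _ (\int[mu]_t ((M * \prod_(i < n) (m \o S) i)%:E * (g 0%N t)%:E))%E).
  apply: ge0_le_integral => //.
  - by move=> t _; rewrite mule_ge0 ?lee_fin// integral_ge0// => v _;
      rewrite lee_fin tuple_prod_ge0// => i u; exact: g0.
  - apply: emeasurable_funM; first by apply/measurable_EFinP; exact: mg.
    by apply: measurable_integral_tuple_prod => // i; [exact: mg|exact: g0].
  - by apply: measurable_funeM; apply/measurable_EFinP; exact: mg.
  - move=> t _; rewrite [leRHS]muleC lee_wpmul2l ?lee_fin//.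
    by apply: IH => // i; [exact: mg|exact: g0|exact: gm].
rewrite ge0_integralZl//; last 2 first.
- by apply/measurable_EFinP; exact: mg.
- by move=> t _; rewrite lee_fin.
apply: (@le_trans _ _ ((M * \prod_(i < n) (m \o S) i)%:E * (m 0%N)%:E))%E.
  by rewrite lee_wpmul2l// lee_fin.
by rewrite -EFinM lee_fin big_ord_recl -mulrA [X in _ * X]mulrC.
Qed.

(** The companion of [integral_tuple_prod_le] for a weight on the dependent coordinate. One free
    variable is spent on integrating [h], by reflection, with its own factor bounded by 1; the other
    variables contribute at most 1 each. *)
Lemma integral_tuple_prod_le_last n g h s H : (0 < n)%N ->
  (forall i, measurable_fun setT (g i)) -> measurable_fun setT h ->
  (forall i t, 0 <= g i t <= 1) -> (forall t, 0 <= h t) ->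
  (forall i, (\int[mu]_t (g i t)%:E <= 1)%E) -> (\int[mu]_t (h t)%:E <= H%:E)%E ->
  (\int[lebesgue_tuple R n]_v (tuple_prod g h s v)%:E <= H%:E)%E.
Proof.
case: n => // n _ mg mh g01 h0 gi hH.
have H0 : 0 <= H by rewrite -lee_fin; apply: le_trans hH; apply: integral_ge0 => t _; rewrite lee_fin.
elim: n g s mg g01 gi => [|n IH] g s mg g01 gi;
    have g0 i t : 0 <= g i t by case/andP: (g01 i t).
  rewrite integral_tuple_prodS//; apply: le_trans hH.
  rewrite -(@ge0_integral_reflect _ s (EFin \o h)) => [| |t]; last 2 first.
  - exact/measurable_EFinP.
  - by rewrite lee_fin.
  apply: ge0_le_integral => //.
  - by move=> t _; rewrite integral_tuple_prod0 mule_ge0 ?lee_fin.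
  - apply: emeasurable_funM; first by apply/measurable_EFinP; exact: mg.
    by apply: measurable_integral_tuple_prod => // i; [exact: mg|exact: g0].
  - apply/measurable_EFinP; apply: measurableT_comp mh _.
    exact: measurable_funB.
  - move=> t _; rewrite integral_tuple_prod0 -EFinM lee_fin ler_piMl//.
    by case/andP: (g01 0%N t).
rewrite integral_tuple_prodS//.
apply: (@le_trans _ _ (\int[mu]_t (H%:E * (g 0%N t)%:E))%E).
  apply: ge0_le_integral => //.
  - by move=> t _; rewrite mule_ge0 ?lee_fin// integral_ge0// => v _;
      rewrite lee_fin tuple_prod_ge0// => i u; exact: g0.
  - apply: emeasurable_funM; first by apply/measurable_EFinP; exact: mg.
    by apply: measurable_integral_tuple_prod => // i; [exact: mg|exact: g0].
  - by apply: measurable_funeM; apply/measurable_EFinP; exact: mg.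
  - move=> t _; rewrite [leRHS]muleC lee_wpmul2l ?lee_fin//.
    by apply: IH => i; [exact: mg|exact: g01|exact: gi].
rewrite ge0_integralZl//; last 2 first.
- by apply/measurable_EFinP; exact: mg.
- by move=> t _; rewrite lee_fin.
by rewrite -[leRHS]mule1 lee_wpmul2l// lee_fin.
Qed.

End DirichletConst.

(** * Integration against the Dirichlet weight and the posterior mean *)

Section Simplex.
Context {R : realType} {n : nat}.
Local Notation k := n.+1.
Local Notation mu := (@lebesgue_measure R).
Local Notation nu := (lebesgue_tuple R k.-1).
Local Notation b := (alpha_hat - 1 : R).
Implicit Types (theta : k.-1.-tuple R) (i : 'I_k) (f : {ffun 'I_k -> nat}) (F : k.-1.-tuple R -> R).

Let b0 : 0 < b.
Proof. by have /andP[a1 _] := @alpha_hat_bounds R; lra. Qed.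

Lemma tuple_prod_coord (g : nat -> R -> R) h theta : tuple_prod g h 1 theta =
  \prod_(i < k) (if (i < n)%N then g i else h) (coord theta i).
Proof.
rewrite big_ord_recr/= coord_last ltnn /tuple_prod; congr (_ * _).
by apply: eq_bigr => i _; rewrite coord_widen ltn_ord.
Qed.

Lemma measurable_coord i : measurable_fun setT (fun theta => coord theta i).
Proof.
have [->|ni] := eqVneq i ord_max.
  under eq_fun do rewrite coord_last.
  by apply: measurable_funB => //; exact: measurable_sum_tuple.
have ilt : (i < n)%N by rewrite ltn_neqAle -ltnS ltn_ord andbT.
have -> : i = widen_ord (leqnSn n) (Ordinal ilt) by exact: val_inj.
under eq_fun do rewrite coord_widen.
exact: measurable_tnth.
Qed.

(** The unnormalized Dirichlet density, extended by 0 outside the simplex. *)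
Definition simplex_weight theta : R := \prod_(i < k) pow_pos b (coord theta i).

Lemma simplex_weight_ge0 theta : 0 <= simplex_weight theta.
Proof. by apply: prodr_ge0 => i _; exact: pow_pos_ge0. Qed.

Lemma simplex_weight_out theta : ~ Delta k theta -> simplex_weight theta = 0.
Proof.
move=> D; have [i ti] : exists i, coord theta i < 0.
  by apply: contrapT => h; apply: D => i; rewrite leNgt; apply/negP => ti; apply: h; exists i.
by apply/eqP/prodf_eq0; exists i => //; rewrite pow_pos_le0// ltW.
Qed.

Lemma measurable_simplex_weight : measurable_fun setT simplex_weight.
Proof.
apply: measurable_prod => i _; apply: measurableT_comp (measurable_coord i).
exact: measurable_pow_pos.
Qed.

Lemma measurable_Delta_eps eps : measurable (Delta_eps k eps : set (k.-1.-tuple R)).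
Proof.
have -> : Delta_eps k eps = \bigcap_(i in [set: 'I_k])
    ((fun theta => coord theta i) @^-1` `[Num.max 0 eps, +oo[ : set (k.-1.-tuple R)).
  apply/seteqP; split=> [theta [D De] i _|theta De] /=.
    by rewrite in_itv/= andbT ge_max (D i) De.
  by split=> i; have := De i I; rewrite /= in_itv/= andbT ge_max => /andP[].
apply: fin_bigcap_measurable => // i _; rewrite -[X in measurable X]setTI.
exact: measurable_coord.
Qed.

(** A class of integrands closed under sums and products and integrable against [simplex_weight];
    bounds outside the simplex are irrelevant because the weight is 0 there. *)
Definition simplex_bounded F :=
  measurable_fun setT F /\ exists C, forall theta, Delta k theta -> `|F theta| <= C.

Lemma simplex_bounded_cst c : simplex_bounded (fun=> c).
Proof. by split; [exact: measurable_cst|exists `|c|]. Qed.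

Lemma simplex_boundedD F G : simplex_bounded F -> simplex_bounded G ->
  simplex_bounded (fun theta => F theta + G theta).
Proof.
move=> [mF [C FC]] [mG [D GD]]; split; first exact: measurable_funD.
by exists (C + D) => theta t; rewrite (le_trans (ler_normD _ _))// lerD ?FC ?GD.
Qed.

Lemma simplex_boundedM F G : simplex_bounded F -> simplex_bounded G ->
  simplex_bounded (fun theta => F theta * G theta).
Proof.
move=> [mF [C FC]] [mG [D GD]]; split; first exact: measurable_funM.
by exists (C * D) => theta t; rewrite normrM ler_pM ?FC ?GD.
Qed.

Lemma simplex_bounded_sum (I : Type) (r : seq I) (F : I -> k.-1.-tuple R -> R) :
  (forall j, simplex_bounded (F j)) -> simplex_bounded (fun theta => \sum_(j <- r) F j theta).
Proof.
move=> bF; elim: r => [|j r IH].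
  by under eq_fun do rewrite big_nil; exact: simplex_bounded_cst.
by under eq_fun do rewrite big_cons; exact: simplex_boundedD.
Qed.

Lemma simplex_bounded_coord i : simplex_bounded (fun theta => coord theta i).
Proof.
split; first exact: measurable_coord.
exists 1 => theta D; by rewrite ger0_norm ?(D i)// coord_le1.
Qed.

Lemma simplex_bounded_prod (f : {ffun 'I_k -> nat}) :
  simplex_bounded (fun theta => \prod_i coord theta i ^+ f i).
Proof.
split.
  apply: measurable_prod => i _; apply: measurable_funX; exact: measurable_coord.
exists 1 => theta D; rewrite ger0_norm ?prodr_ge0// => [|i _]; last by rewrite exprn_ge0.
apply: prodr_ile1 => i _; rewrite exprn_ge0//= exprn_ile1// ?(D i)//.
exact: coord_le1.
Qed.

(* The exponents of [simplex_weight] times a monomial, indexed by nat. *)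
Definition exponents f (j : nat) : R := b + (if (j < k)%N then f (inord j) else 0%N)%:R.

Lemma exponents_gt0 f j : 0 < exponents f j.
Proof. by rewrite ltr_pwDl. Qed.

Lemma exponentsE f i : exponents f i = b + (f i)%:R.
Proof. by rewrite /exponents ltn_ord inord_val. Qed.

Lemma moment_integral (f : {ffun 'I_k -> nat}) :
  (\int[nu]_theta (\prod_i coord theta i ^+ f i * simplex_weight theta)%:E =
  (dirichlet_const n (exponents f))%:E)%E.
Proof.
have := integral_dirichlet n 1 (exponents_gt0 f).
rewrite /pow_pos max_r// powR1 mulr1 => <-; apply: eq_integral => theta _.
rewrite tuple_prod_coord /simplex_weight -big_split/=.
congr EFin; apply: eq_bigr => i _; rewrite (_ : (if _ then _ else _) = pow_pos (exponents f i)).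
  rewrite exponentsE.
  have [ti|ti] := ltP (coord theta i) 0.
    by rewrite !pow_pos_le0 ?mulr0 ?(ltW ti)// ltr_pwDl.
  rewrite !pow_posE// -powR_mulrn// -powRD 1?addrC//.
  by apply/implyP => /eqP h; have := b0; have := @ler0n R (f i); lra.
case: ltnP => // ni; congr (pow_pos (exponents f _)).
by apply/eqP; rewrite eqn_leq ni -ltnS ltn_ord.
Qed.

Lemma simplex_integrable F : simplex_bounded F ->
  nu.-integrable setT (fun theta => (F theta * simplex_weight theta)%:E).
Proof.
move=> [mF [C FC]].
have mW := measurable_simplex_weight.
have intW : (\int[nu]_theta (simplex_weight theta)%:E =
    (dirichlet_const n (exponents [ffun=> 0%N]))%:E)%E.
  rewrite -moment_integral; apply: eq_integral => theta _.
  by rewrite big1 ?mul1r// => i _; rewrite ffunE expr0.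
have iW : nu.-integrable setT (fun theta => (simplex_weight theta)%:E).
  apply/integrableP; split; first exact/measurable_EFinP.
  under eq_integral => theta _ do rewrite gee0_abs ?lee_fin ?simplex_weight_ge0//.
  by rewrite intW ltry.
apply: (@le_integrable _ _ _ _ _ measurableT _ (fun theta => C%:E * (simplex_weight theta)%:E)%E) => //.
- by apply/measurable_EFinP; exact: measurable_funM.
- move=> theta _; rewrite -EFinM !abse_EFin lee_fin.
  have [D|D] := pselect (Delta k theta); last by rewrite simplex_weight_out// !mulr0.
  rewrite !normrM ler_wpM2r// (le_trans (FC _ D))//.
  exact: ler_norm.
- exact: integrableZl.
Qed.

Definition simplex_int F : R := (\int[nu]_theta (F theta * simplex_weight theta))%R.

Lemma EFin_simplex_int F : simplex_bounded F ->
  ((simplex_int F)%:E = \int[nu]_theta (F theta * simplex_weight theta)%:E)%E.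
Proof.
move=> bF; rewrite /simplex_int /Rintegral fineK//.
exact: integrable_fin_num (simplex_integrable bF).
Qed.

Lemma simplex_intD F G : simplex_bounded F -> simplex_bounded G ->
  simplex_int (fun theta => F theta + G theta) = simplex_int F + simplex_int G.
Proof.
move=> bF bG; rewrite /simplex_int -RintegralD//; last 2 first.
- exact: simplex_integrable.
- exact: simplex_integrable.
by apply: eq_Rintegral => theta _; rewrite mulrDl.
Qed.

Lemma simplex_intZ c F : simplex_bounded F ->
  simplex_int (fun theta => c * F theta) = c * simplex_int F.
Proof.
move=> bF; rewrite /simplex_int -RintegralZl//; last exact: simplex_integrable.
by apply: eq_Rintegral => theta _; rewrite mulrA.
Qed.

Lemma simplex_int_sum (I : Type) (r : seq I) (F : I -> k.-1.-tuple R -> R) :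
  (forall j, simplex_bounded (F j)) ->
  simplex_int (fun theta => \sum_(j <- r) F j theta) = \sum_(j <- r) simplex_int (F j).
Proof.
move=> bF; elim: r => [|j r IH].
  rewrite big_nil /simplex_int; under eq_Rintegral do rewrite big_nil mul0r.
  by rewrite Rintegral_cst// mul0r.
rewrite big_cons -IH -simplex_intD//; last exact: simplex_bounded_sum.
by apply: eq_Rintegral => theta _; rewrite big_cons.
Qed.

Lemma le_simplex_int F G : simplex_bounded F -> simplex_bounded G ->
  (forall theta, Delta k theta -> F theta <= G theta) -> simplex_int F <= simplex_int G.
Proof.
move=> bF bG FG; apply: le_Rintegral => //; [exact: simplex_integrable..|].
move=> theta _; have [D|D] := pselect (Delta k theta); last by rewrite simplex_weight_out// !mulr0.
by rewrite ler_wpM2r ?FG ?simplex_weight_ge0.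
Qed.

Lemma simplex_int_ge0 F : (forall theta, Delta k theta -> 0 <= F theta) -> 0 <= simplex_int F.
Proof.
move=> F0; apply: Rintegral_ge0 => theta _.
have [D|D] := pselect (Delta k theta); last by rewrite simplex_weight_out// mulr0.
by rewrite mulr_ge0 ?F0 ?simplex_weight_ge0.
Qed.

Definition moment (f : {ffun 'I_k -> nat}) : R :=
  simplex_int (fun theta => \prod_i coord theta i ^+ f i).

Lemma momentE f : moment f = dirichlet_const n (exponents f).
Proof. by rewrite /moment /simplex_int /Rintegral moment_integral. Qed.

Lemma moment_gt0 f : 0 < moment f.
Proof. by rewrite momentE dirichlet_const_gt0// => i; exact: exponents_gt0. Qed.

(** Applied once at the counts this gives the posterior mean, and applied twice the posterior second
    moment. *)
Lemma moment_incr f i :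
  ((\sum_j f j)%N%:R + k%:R * alpha_hat) * moment (incr f i) = ((f i)%:R + alpha_hat) * moment f.
Proof.
rewrite !momentE.
have ik : (i <= n)%N by rewrite -ltnS.
have := dirichlet_const_incr (exponents_gt0 f) ik; rewrite exponentsE.
have -> : dirichlet_sum n (exponents f) = (\sum_j f j)%N%:R + k%:R * alpha_hat.
  rewrite /dirichlet_sum natr_sum [_ * alpha_hat]mulrC mulr_natr.
  have -> : alpha_hat *+ k = \sum_(j < k) (alpha_hat : R) by rewrite sumr_const card_ord.
  by rewrite -big_split/=; apply: eq_bigr => j _; rewrite exponentsE; ring.
move=> e; rewrite (_ : (f i)%:R + alpha_hat = b + (f i)%:R + 1); last by ring.
rewrite -e; congr (_ * dirichlet_const _ _); apply/funext => j.
rewrite /exponents; case: ltnP => jk; last by rewrite (gtn_eqF (leq_trans (ltn_ord i) jk)) !addr0.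
by rewrite ffunE natrD addrA -val_eqE/= inordK.
Qed.

Lemma multinomial_pmf_moment N (x : counts k N) :
  simplex_int (fun theta => multinomial_pmf theta x) =
  N`!%:R / \prod_i (count_vec x i)`!%:R * moment (count_vec x).
Proof.
rewrite /moment -simplex_intZ; last exact: simplex_bounded_prod.
by apply: eq_Rintegral => theta _; rewrite multinomial_pmfE.
Qed.

Lemma prod_coord_incr theta f i :
  \prod_j coord theta j ^+ incr f i j = coord theta i * \prod_j coord theta j ^+ f j.
Proof.
rewrite (bigD1 i)//= [in RHS](bigD1 i)//= ffunE eqxx addn1 exprS -mulrA; congr (_ * (_ * _)).
by apply: eq_bigr => j /negbTE ji; rewrite ffunE ji addn0.
Qed.

Lemma Rintegral_Delta F G : (forall theta, Delta k theta -> F theta = G theta * simplex_weight theta) ->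
  (\int[nu]_(theta in Delta k) F theta)%R = simplex_int G.
Proof.
move=> FG; rewrite Rintegral_mkcond; apply: eq_Rintegral => theta _; rewrite patchE.
case: ifPn => [/[!inE]/FG//|/negP D]; rewrite simplex_weight_out ?mulr0// => h.
by apply: D; rewrite inE.
Qed.

Lemma simplex_weightE theta : Delta k theta ->
  \prod_i coord theta i `^ b = simplex_weight theta.
Proof. by move=> D; apply: eq_bigr => i _; rewrite pow_posE. Qed.

(** The multinomial coefficient and the prior constant [c0] cancel against the posterior
    normalization, leaving a ratio of consecutive moments. *)
Lemma bayes_predictive_dirichlet N (x : counts k N) i :
  @bayes_predictive R k N (dirichlet_density k alpha_hat) x (obs i) = dirichlet_pred x i.
Proof.
pose c0 : R := (\int[nu]_(t in Delta k) \prod_i coord t i `^ b)%R.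
pose m := N`!%:R / \prod_i (count_vec x i)`!%:R : R.
have m0 : m != 0.
  have fn0 j : j`!%:R != 0 :> R by rewrite pnatr_eq0 -lt0n fact_gt0.
  by rewrite mulf_neq0 ?invr_neq0//; apply/prodf_neq0.
have c00 : c0 != 0.
  rewrite /c0 (Rintegral_Delta (G := fun theta => \prod_i coord theta i ^+ [ffun=> 0%N] i)).
    exact/lt0r_neq0/moment_gt0.
  by move=> theta D; rewrite simplex_weightE// big1 ?mul1r// => j _; rewrite ffunE expr0.
have f0 := lt0r_neq0 (moment_gt0 (count_vec x)).
pose K : R := (\int[nu]_(t in Delta k) (multinomial_pmf t x * dirichlet_density k alpha_hat t))%R.
have KE : K = m / c0 * moment (count_vec x).
  rewrite /moment -simplex_intZ; last exact: simplex_bounded_prod.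
  apply: Rintegral_Delta => theta D.
  by rewrite /dirichlet_density -/c0 simplex_weightE// multinomial_pmfE -/m; ring.
rewrite /bayes_predictive.
transitivity (m / c0 / K * moment (incr (count_vec x) i)).
  rewrite /moment -simplex_intZ; last exact: simplex_bounded_prod.
  apply: Rintegral_Delta => theta D.
  rewrite /posterior -/K /dirichlet_density -/c0 simplex_weightE// multinomial_pmf_obs.
  by rewrite multinomial_pmfE -/m prod_coord_incr; ring.
have := moment_incr (count_vec x) i; rewrite sum_count_vec /dirichlet_pred KE => e.
have /andP[a1 _] := @alpha_hat_bounds R.
have A0 : N%:R + k%:R * alpha_hat != 0 :> R.
  by apply/lt0r_neq0; rewrite ltr_wpDl// mulr_gt0//; lra.
apply: (mulfI A0); rewrite [RHS]mulrC divfK// mulrCA e; field.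
by rewrite m0 c00 f0.
Qed.

End Simplex.

(** * Mass outside the truncated simplex and the truncated integral of [theta_i^-2] *)

Section Bounds.
Context {R : realType} {n : nat} (n0 : (0 < n)%N).
Local Notation k := n.+1.
Local Notation mu := (@lebesgue_measure R).
Local Notation nu := (lebesgue_tuple R k.-1).
Local Notation b := (alpha_hat - 1 : R).
Implicit Types (theta : k.-1.-tuple R) (i : 'I_k) (F : k.-1.-tuple R -> R).

Let b0 : 0 < b.
Proof. by have /andP[a1 _] := @alpha_hat_bounds R; lra. Qed.

Let u : R -> R := \1_(`[0%R, 1%R]%classic : set R).

Let mu_u : measurable_fun setT u.
Proof. exact: measurable_indic. Qed.

Let u01 t : 0 <= u t <= 1.
Proof. by rewrite /u indicE; case: (_ \in _); rewrite ?lexx ?ler01. Qed.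

Let int_u : (\int[mu]_t (u t)%:E = 1)%E.
Proof.
by rewrite integral_indic//= setIT lebesgue_measure_itv/= lte_fin ltr01 oppr0 adde0.
Qed.

(* The variables other than [coord theta i] contribute at most 1 because
   they range over [0, 1]. *)
Lemma simplex_int_le i F (phi : R -> R) H : simplex_bounded F ->
  measurable_fun setT phi -> (forall t, 0 <= phi t) -> (\int[mu]_t (phi t)%:E <= H%:E)%E ->
  (forall theta, Delta k theta -> 0 <= F theta) ->
  (forall theta, Delta k theta -> F theta * pow_pos b (coord theta i) <= phi (coord theta i)) ->
  simplex_int F <= H.
Proof.
move=> bF mphi phi0 phiH F0 Fphi.
have u0 t : 0 <= u t by case/andP: (u01 t).
have H0 : 0 <= H.
  by rewrite -lee_fin; apply: le_trans phiH; apply: integral_ge0 => t _; rewrite lee_fin.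
pose G j := if j == i then phi else u.
have FG theta : F theta * simplex_weight theta <= \prod_j G j (coord theta j).
  have G0 : 0 <= \prod_j G j (coord theta j).
    by apply: prodr_ge0 => j _; rewrite /G; case: ifP.
  have [D|D] := pselect (Delta k theta); last by rewrite simplex_weight_out// mulr0.
  rewrite /simplex_weight (bigD1 i)//= [leRHS](bigD1 i)//= mulrA {1}/G eqxx.
  apply: ler_pM; rewrite ?mulr_ge0 ?prodr_ge0 ?F0 ?pow_pos_ge0 ?Fphi//.
    by move=> j _; exact: pow_pos_ge0.
  apply: ler_prod => j /negbTE ji; rewrite pow_pos_ge0/= /G ji /u indicE mem_set/=.
    by apply: pow_pos_le1 => //; exact: coord_le1.
  by rewrite in_itv/= (D j) coord_le1.
rewrite -lee_fin EFin_simplex_int//.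
have mFW : measurable_fun setT (fun theta => (F theta * simplex_weight theta)%:E).
  by case/integrableP: (simplex_integrable bF).
have FW0 theta : (0 <= (F theta * simplex_weight theta)%:E)%E.
  rewrite lee_fin; have [D|D] := pselect (Delta k theta); last by rewrite simplex_weight_out// mulr0.
  by rewrite mulr_ge0 ?F0 ?simplex_weight_ge0.
have key g h : (forall j, measurable_fun setT (g j)) -> measurable_fun setT h ->
    (forall theta, \prod_j G j (coord theta j) = tuple_prod g h 1 theta) ->
    (\int[nu]_theta (tuple_prod g h 1 theta)%:E <= H%:E)%E ->
    (\int[nu]_theta (F theta * simplex_weight theta)%:E <= H%:E)%E.
  move=> mg mh GE; apply: le_trans; apply: ge0_le_integral => //.
    by apply/measurable_EFinP; exact: measurable_tuple_prod.
  by move=> theta _; rewrite lee_fin -GE.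
(* The last coordinate is not a variable of integration, so the two positions of [i] call for
   different product bounds. *)
have [ni|/eqP ni] := eqVneq (i : nat) n.
  apply: (key (fun=> u) phi) => // [theta|].
    rewrite tuple_prod_coord; apply: eq_bigr => j _; rewrite /G -val_eqE/= ni.
    by case: ltngtP => // jn; have := ltn_ord j; rewrite ltnNge jn.
  by apply: integral_tuple_prod_le_last => // _; rewrite int_u.
apply: (key (fun j => if j == i :> nat then phi else u) u) => //.
- by move=> j; case: ifP.
- move=> theta; rewrite tuple_prod_coord; apply: eq_bigr => j _; rewrite /G -val_eqE/=.
  case: ltnP => // nj; rewrite (_ : (j == i :> nat) = false)//.
  by apply/negbTE/eqP => ji; apply: ni; rewrite -ji; apply/eqP; rewrite eqn_leq nj -ltnS ltn_ord.
have -> : H = 1 * \prod_(j < n) (if j == i :> nat then H else 1).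
  have ilt : (i < n)%N by rewrite ltn_neqAle -ltnS ltn_ord andbT; apply/eqP.
  rewrite mul1r (bigD1 (Ordinal ilt))//= eqxx big1 ?mulr1// => j /negbTE ji.
  by rewrite -val_eqE/= in ji; rewrite ji.
apply: (@integral_tuple_prod_le _ _ _ _ _ _ (fun j => if j == i :> nat then H else 1)) => //.
- by move=> j; case: ifP.
- by move=> j t; case: ifP.
- by move=> j; case: ifP => // _; rewrite int_u.
Qed.

Section Eps.
Context (eps : R) (e01 : 0 < eps < 1).
Local Notation G := (\1_(Delta_eps k eps) : k.-1.-tuple R -> R).

Lemma simplex_bounded_indic : simplex_bounded G.
Proof.
split; first by apply: measurable_indic; exact: measurable_Delta_eps.
by exists 1 => theta _; rewrite indicE; case: (_ \in _); rewrite /= ?normr1 ?normr0 ?lexx ?ler01.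
Qed.

(** A union bound over the [k] strips [theta_i <= eps]; on each, [t^(a-1) <= eps^(a-1)] over an
    interval of length [eps]. *)
Lemma simplex_int_out_le :
  simplex_int (fun theta => 1 + -1 * G theta) <= k%:R * eps `^ (alpha_hat).
Proof.
have /andP[e0 e1] := e01.
pose V i : set (k.-1.-tuple R) := (fun theta => coord theta i) @^-1` `[0%R, eps]%classic.
have mV i : measurable (V i).
  by rewrite -[V i]setTI; apply: measurable_coord.
pose F i : k.-1.-tuple R -> R := \1_(V i).
have bF i : simplex_bounded (F i).
  split; first exact: measurable_indic.
  by exists 1 => theta _; rewrite /F indicE; case: (_ \in _); rewrite /= ?normr1 ?normr0 ?lexx ?ler01.
have bG : simplex_bounded (fun theta => 1 + -1 * G theta).
  apply: simplex_boundedD; first exact: simplex_bounded_cst.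
  by apply: simplex_boundedM; [exact: simplex_bounded_cst|exact: simplex_bounded_indic].
apply: (@le_trans _ _ (simplex_int (fun theta => \sum_(i < k) F i theta))).
  apply: le_simplex_int => //; first exact: simplex_bounded_sum.
  move=> theta D; rewrite indicE.
  have F0 i : 0 <= F i theta by rewrite /F indicE; case: (_ \in _); rewrite ?lexx ?ler01.
  case: (boolP (_ \in _)) => [_|/negP Dn]; first by rewrite mulr1 subrr sumr_ge0.
  rewrite mulr0 addr0; have [i ti] : exists i, coord theta i < eps.
    apply: contrapT => h; apply: Dn; rewrite inE; split=> // i.
    by rewrite leNgt; apply/negP => ti; apply: h; exists i.
  rewrite (bigD1 i)//= {1}/F indicE mem_set/= ?lerDl ?sumr_ge0//.
  by rewrite /V/= in_itv/= (D i) ltW.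
rewrite simplex_int_sum// -[k in k%:R]card_ord mulr_natl -sumr_const.
apply: ler_sum => i _.
apply: (@simplex_int_le i _ (fun t => eps `^ b * \1_(`[0%R, eps]%classic : set R) t)) => //.
- apply: measurable_funM; first exact: measurable_cst.
  exact: measurable_indic.
- by move=> t; rewrite mulr_ge0 ?powR_ge0 ?indicE.
- under eq_integral do rewrite EFinM.
  rewrite ge0_integralZl//; [|exact/measurable_EFinP/measurable_indic|by rewrite lee_fin powR_ge0].
  rewrite integral_indic//= setIT lebesgue_measure_itv/= lte_fin e0 oppr0 adde0.
  by rewrite -EFinM lee_fin mulrC mulr_powRB1// ?ltW//; have := b0; lra.
- move=> theta D; rewrite /F !indicE /V.
  case: (boolP (theta \in _)) => [/[!inE]/= h|_]; last by rewrite mul0r mulr_ge0 ?powR_ge0.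
  rewrite mem_set// mul1r mulr1 pow_posE//.
  rewrite ge0_ler_powR ?nnegrE ?(ltW b0) ?(ltW e0) ?(D i)//.
  by move: h; rewrite in_itv/= => /andP[].
Qed.

Definition eps_inv2 i theta :=  G theta * coord theta i `^ (- 2).

Lemma simplex_bounded_inv2 i : simplex_bounded (eps_inv2 i).
Proof.
have /andP[e0 e1] := e01; split.
  apply: measurable_funM; first by apply: measurable_indic; exact: measurable_Delta_eps.
  exact: (measurableT_comp (@measurable_powR R (- 2)) (measurable_coord i)).
exists (eps `^ (- 2)) => theta D; rewrite /eps_inv2 indicE.
case: (boolP (_ \in _)) => [/[!inE]-[_ De]|_]; last by rewrite mul0r normr0 powR_ge0.
rewrite mul1r ger0_norm ?powR_ge0// !powRN lef_pV2 ?posrE ?powR_gt0//.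
  by rewrite ge0_ler_powR ?nnegrE ?(ltW e0) ?(D i)//; exact: De.
exact: lt_le_trans (De i).
Qed.

(** The weight is at most 1, and [t^-2] integrates over [[eps, 1]] to [1 / eps - 1]. This gains a
    factor [eps] over the pointwise bound. *)
Lemma simplex_int_inv2_le i : simplex_int (eps_inv2 i) <= eps^-1.
Proof.
have /andP[e0 e1] := e01.
pose E := `[eps, 1%R]%classic : set R.
have mE : measurable E by exact: measurable_itv.
apply: (@simplex_int_le i _ (fun t => \1_E t * t `^ (- 2))) => //.
- exact: simplex_bounded_inv2.
- by apply: measurable_funM; [exact: measurable_indic|exact: measurable_powR].
- by move=> t; rewrite mulr_ge0 ?powR_ge0 ?indicE.
- have -> : (\int[mu]_t (\1_E t * t `^ (- 2))%:E = \int[mu]_(t in E) (t `^ (- 2))%:E)%E.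
    rewrite [RHS]integral_mkcond; apply: eq_integral => t _; rewrite patchE indicE.
    by case: ifP => _; rewrite ?mul1r ?mul0r.
  have dinv (t : R) : 0 < t -> is_derive t 1 (fun t => - t^-1) (t `^ (- 2)).
    move=> t0; have t1 : t != 0 by rewrite gt_eqF.
    have dV : is_derive t 1 (fun t => t^-1) _ := is_deriveV (f := id) t1 (is_derive_id t 1).
    apply: is_derive_eq; rewrite powR_invn ?ltW// /GRing.scale/=; ring.
  rewrite (@continuous_FTC2 R _ (fun t => - t^-1) eps 1)//.
  + by rewrite -EFinB lee_fin invr1; lra.
  + apply: continuous_in_subspaceT => t; rewrite inE/= in_itv/= => /andP[et _].
    apply/differentiable_continuous/derivable1_diffP/derivable_powR.
    by rewrite in_itv/= (lt_le_trans e0 et).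
  + have ct t : 0 < t -> {for t, continuous (fun t : R => - t^-1)}.
      move=> t0; apply/differentiable_continuous/derivable1_diffP.
      by have [] := dinv t t0.
    split=> [t||].
    * by rewrite in_itv/= => /andP[et _]; have [] := dinv t (lt_trans e0 et).
    * exact/cvg_at_right_filter/ct.
    * exact/cvg_at_left_filter/ct.
  + move=> t; rewrite in_itv/= derive1E => /andP[et _].
    by have [_ ->] := dinv t (lt_trans e0 et).
- by move=> theta D; rewrite /eps_inv2 mulr_ge0 ?powR_ge0 ?indicE.
- move=> theta D; rewrite /eps_inv2 !indicE.
  case: (boolP (theta \in _)) => [/[!inE]-[_ De]|_]; last by rewrite !mul0r mulr_ge0 ?powR_ge0.
  rewrite mem_set; last by rewrite /E/= in_itv/= De coord_le1.
  by rewrite !mul1r ler_piMr ?powR_ge0 ?pow_pos_le1 ?coord_le1.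
Qed.

End Eps.

End Bounds.

(** * Elementary inequalities: discriminant, Gibbs, and the algebra of the covariance bound *)

Lemma discriminant_le (R : realFieldType) (a b c : R) : 0 <= a ->
  (forall l, 0 <= l ^+ 2 * a + 2 * l * b + c) -> b ^+ 2 <= a * c.
Proof.
rewrite le_eqVlt => /predU1P[<-|a0] h.
  have [->|b0] := eqVneq b 0; first by rewrite expr0n mul0r.
  (* With [a = 0] the form is affine; this [l] gives it the value -1, which is impossible. *)
  have := h (- (c + 1) / (2 * b)); rewrite mulr0 add0r.
  have -> : 2 * (- (c + 1) / (2 * b)) * b = - (c + 1) by field.
  lra.
have := h (- b / a); rewrite -(ler_pM2r a0) mul0r.
have -> : ((- b / a) ^+ 2 * a + 2 * (- b / a) * b + c) * a = a * c - b ^+ 2.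
  by field; rewrite gt_eqF.
by rewrite subr_ge0.
Qed.

Lemma ln_le_subr1 (R : realType) (x : R) : 0 < x -> ln x <= x - 1.
Proof.
move=> x0; have := @le_ln1Dx R (x - 1); rewrite (_ : 1 + (x - 1) = x); last by ring.
by apply; lra.
Qed.

(* Gibbs' inequality followed by KL <= chi^2; both reduce to ln x <= x - 1. *)
Lemma sum_ln_ratio_le (R : realType) (I : finType) (t p q : I -> R) (T : R) :
  0 < T -> (forall i, 0 < t i) -> (forall i, 0 < p i) -> (forall i, 0 < q i) ->
  \sum_i t i = T -> \sum_i p i = 1 -> \sum_i q i = 1 ->
  \sum_i t i * (ln (q i) - ln (p i)) <= \sum_i (t i - T * p i) ^+ 2 / (T * p i).
Proof.
move=> T0 t0 p0 q0 st sp sq.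
(* The two added differences each sum to 0; they make the inequality hold term by term. *)
apply: (@le_trans _ _ (\sum_i ((q i * T - t i) + (t i - T * p i) +
    (t i - T * p i) ^+ 2 / (T * p i)))); last first.
  rewrite !big_split/= !sumrN -mulr_suml -mulr_sumr sq sp st.
  by rewrite mul1r mulr1 subrr !add0r.
apply: ler_sum => i _; have ti := t0 i; have pi := p0 i; have qi := q0 i.
have h1 : ln (q i) + ln T - ln (t i) <= q i * T / t i - 1.
  by rewrite -lnM ?posrE// -ln_div ?posrE ?mulr_gt0// ln_le_subr1 ?divr_gt0 ?mulr_gt0.
have h2 : ln (t i) - (ln T + ln (p i)) <= t i / (T * p i) - 1.
  by rewrite -lnM ?posrE// -ln_div ?posrE ?mulr_gt0// ln_le_subr1 ?divr_gt0 ?mulr_gt0.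
have -> : q i * T - t i + (t i - T * p i) + (t i - T * p i) ^+ 2 / (T * p i) =
    t i * ((q i * T / t i - 1) + (t i / (T * p i) - 1)).
  by field; rewrite !gt_eqF.
by rewrite ler_pM2l//; move: h1 h2; lra.
Qed.

Lemma truncated_variance_identity (R : realFieldType) (T M p a : R) : M != 0 -> a + 1 != 0 ->
  T * (M - T) * (p * (1 - p) / (a + 1)) = (T * (M - T) / M) * (p * (1 - p) * M / (a + 1)).
Proof. by move=> M0 a1; field; rewrite M0 a1. Qed.

(** Two forms of the integral of [m (l (g - T/M) + (c - p))^2] with [g^2 = g]: on the left by powers
    of [l], as [discriminant_le] requires, on the right by moments, as linearity of the integral
    produces them. *)
Lemma truncated_square_identity (R : realFieldType) (l T M t p a : R) : M != 0 -> a + 1 != 0 ->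
  l ^+ 2 * (T * (M - T) / M) + 2 * l * (t - T * p) + p * (1 - p) * M / (a + 1) =
   (l ^+ 2 * (T / M) ^+ 2 + 2 * l * (p * (T / M)) + p ^+ 2) * M +
   ((l ^+ 2 * (1 - 2 * (T / M)) - 2 * l * p) * T +
   ((- 2 * l * (T / M) - 2 * p) * (p * M) +
   (2 * l * t + 1 * ((a * p + 1) * (p * M) / (a + 1))))).
Proof. by move=> M0 a1; field; rewrite M0 a1. Qed.

(** * Lower bound by averaging over the truncated prior *)

Section Minimax.
Context {R : realType} {n : nat} (n0 : (0 < n)%N).
Local Notation k := n.+1.
Implicit Types (theta : k.-1.-tuple R) (i : 'I_k) (F : k.-1.-tuple R -> R).
Context (eps : R) (e01 : 0 < eps < 1) (N : nat).
Local Notation G := (\1_(Delta_eps k eps) : k.-1.-tuple R -> R).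
Local Notation A := (N%:R + k%:R * alpha_hat : R).

Let A0 : 0 < A.
Proof.
have /andP[a1 _] := @alpha_hat_bounds R.
by rewrite ltr_wpDl// mulr_gt0//; lra.
Qed.

Let bG : simplex_bounded G. Proof. exact: simplex_bounded_indic. Qed.

Let bpmf (x : counts k N) : simplex_bounded (fun theta => multinomial_pmf theta x).
Proof.
under eq_fun do rewrite multinomial_pmfE.
by apply: simplex_boundedM; [exact: simplex_bounded_cst|exact: simplex_bounded_prod].
Qed.

Let bcoord := @simplex_bounded_coord R n.

Let G_ge0 theta : 0 <= G theta.
Proof. by rewrite indicE. Qed.

Let GG theta : G theta * G theta = G theta.
Proof. by rewrite indicE; case: (_ \in _); rewrite ?mulr1 ?mulr0. Qed.

Section Observation.
Context (x : counts k N).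

(** For a fixed observation, [M] is its unnormalized marginal mass, [T] the part of it carried by
    the truncated simplex, and [T1 i / T] the posterior mean of [theta_i] under the truncated prior
    when [T] is nonzero. *)
Let p i : R := dirichlet_pred x i.
Let M : R := simplex_int (fun theta => multinomial_pmf theta x).
Let T : R := simplex_int (fun theta => multinomial_pmf theta x * G theta).
Let T1 i : R := simplex_int (fun theta => multinomial_pmf theta x * (G theta * coord theta i)).
Let E1 i : R := simplex_int (fun theta => multinomial_pmf theta x * coord theta i).
Let E2 i : R := simplex_int (fun theta => multinomial_pmf theta x * (coord theta i * coord theta i)).

Let cx : R := N`!%:R / \prod_i (count_vec x i)`!%:R.

Let cx_gt0 : 0 < cx.
Proof. by rewrite divr_gt0 ?prodr_gt0// ?ltr0n ?fact_gt0// => i _; rewrite ltr0n fact_gt0. Qed.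

Let M_gt0 : 0 < M.
Proof. by rewrite /M multinomial_pmf_moment mulr_gt0// moment_gt0. Qed.

Let p_gt0 i : 0 < p i.
Proof.
have /andP[a1 _] := @alpha_hat_bounds R.
by rewrite /p /dirichlet_pred divr_gt0// ltr_wpDl//; lra.
Qed.

Let sum_p : \sum_i p i = 1.
Proof.
rewrite /p /dirichlet_pred -mulr_suml big_split/= -natr_sum sum_count_vec sumr_const card_ord.
by rewrite -[alpha_hat *+ k]mulr_natl divff// gt_eqF.
Qed.

Let E1E i : E1 i = p i * M.
Proof.
have -> : E1 i = cx * moment (incr (count_vec x) i).
  rewrite /moment -simplex_intZ; last exact: simplex_bounded_prod.
  by apply: eq_Rintegral => theta _; rewrite multinomial_pmfE prod_coord_incr -/cx; ring.
have := moment_incr (R := R) (count_vec x) i; rewrite sum_count_vec => e.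
rewrite /M multinomial_pmf_moment -/cx /p /dirichlet_pred.
apply: (mulfI (lt0r_neq0 A0)); rewrite mulrCA e; field.
by rewrite nat1r lt0r_neq0.
Qed.

Let E2E i : (A + 1) * E2 i = (A * p i + 1) * (p i * M).
Proof.
have -> : E2 i = cx * moment (incr (incr (count_vec x) i) i).
  rewrite /moment -simplex_intZ; last exact: simplex_bounded_prod.
  by apply: eq_Rintegral => theta _; rewrite multinomial_pmfE !prod_coord_incr -/cx; ring.
have := moment_incr (R := R) (incr (count_vec x) i) i; rewrite sum_incr sum_count_vec => e.
rewrite -E1E (_ : E1 i = cx * moment (incr (count_vec x) i)); last first.
  rewrite /moment -simplex_intZ; last exact: simplex_bounded_prod.
  by apply: eq_Rintegral => theta _; rewrite multinomial_pmfE prod_coord_incr -/cx; ring.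
have -> : A * p i = (count_vec x i)%:R + alpha_hat by rewrite /p /dirichlet_pred mulrC divfK// gt_eqF.
rewrite mulrCA (_ : A + 1 = N.+1%:R + k%:R * alpha_hat); last by rewrite -[N.+1]addn1 natrD; ring.
by rewrite e ffunE eqxx natrD /=; ring.
Qed.

Let bM F : simplex_bounded F -> simplex_bounded (fun theta => multinomial_pmf theta x * F theta).
Proof. exact: simplex_boundedM. Qed.

Let T_ge0 : 0 <= T.
Proof.
by apply: simplex_int_ge0 => theta D; rewrite mulr_ge0 ?multinomial_pmf_ge0.
Qed.

Let T_le : T <= M.
Proof.
apply: le_simplex_int => //; first exact: bM.
move=> theta D; rewrite ler_piMr ?multinomial_pmf_ge0// indicE lern1; case: (_ \in _).
Qed.

Let bGcoord i : simplex_bounded (fun theta => G theta * coord theta i).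
Proof. exact: simplex_boundedM. Qed.

(** Divided by [M^2], this bounds the squared posterior covariance of the indicator and [theta_i] by
    the product of their variances. It is the discriminant of a form in [l] that is the integral of
    a square. *)
Let cauchy_schwarz i : (T1 i - T * p i) ^+ 2 <= T * (M - T) * (p i * (1 - p i) / (A + 1)).
Proof.
have A1 : A + 1 != 0 by rewrite gt_eqF// addr_gt0.
have Mn0 : M != 0 by rewrite gt_eqF.
have E2E' : E2 i = (A * p i + 1) * (p i * M) / (A + 1) by rewrite -E2E mulrAC divff// mul1r.
rewrite (truncated_variance_identity _ _ Mn0 A1).
apply: discriminant_le; first by rewrite divr_ge0 ?mulr_ge0 ?subr_ge0// ltW.
move=> l; rewrite (truncated_square_identity _ _ _ _ Mn0 A1) -E2E' -E1E.
have bE2 : simplex_bounded (fun theta => multinomial_pmf theta x * (coord theta i * coord theta i)).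
  exact/bM/simplex_boundedM.
rewrite [X in _ <= X](_ : _ = simplex_int (fun theta =>
    (l ^+ 2 * (T / M) ^+ 2 + 2 * l * (p i * (T / M)) + p i ^+ 2) * multinomial_pmf theta x +
    ((l ^+ 2 * (1 - 2 * (T / M)) - 2 * l * p i) * (multinomial_pmf theta x * G theta) +
    ((- 2 * l * (T / M) - 2 * p i) * (multinomial_pmf theta x * coord theta i) +
    (2 * l * (multinomial_pmf theta x * (G theta * coord theta i)) +
    1 * (multinomial_pmf theta x * (coord theta i * coord theta i))))))).
  apply: simplex_int_ge0 => theta D.
  set m := multinomial_pmf theta x; set g := G theta; set c := coord theta i.
  rewrite (_ : _ + _ = m * (l * (g - T / M) + (c - p i)) ^+ 2).
    by rewrite mulr_ge0 ?multinomial_pmf_ge0 ?sqr_ge0.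
  have := GG theta; rewrite -/g => gg.
  rewrite [RHS](_ : _ = (l ^+ 2 * (T / M) ^+ 2 + 2 * l * (p i * (T / M)) + p i ^+ 2) * m +
    ((l ^+ 2 * (- 2 * (T / M)) - 2 * l * p i) * (m * g) +
    ((- 2 * l * (T / M) - 2 * p i) * (m * c) +
    (2 * l * (m * (g * c)) + 1 * (m * (c * c))))) + l ^+ 2 * m * (g * g)); last by ring.
  by rewrite gg; ring.
have bZ F c : simplex_bounded F -> simplex_bounded (fun theta => c * F theta).
  by move=> bF; apply: simplex_boundedM => //; exact: simplex_bounded_cst.
rewrite simplex_intD; [|exact: bZ|]; last first.
  by apply: simplex_boundedD; [exact/bZ/bM|apply: simplex_boundedD; [exact/bZ/bM|
    apply: simplex_boundedD; [exact/bZ/bM|exact: bZ]]].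
rewrite simplex_intD; [|exact/bZ/bM|]; last first.
  by apply: simplex_boundedD; [exact/bZ/bM|apply: simplex_boundedD; [exact/bZ/bM|exact: bZ]].
rewrite simplex_intD; [|exact/bZ/bM|]; last first.
  by apply: simplex_boundedD; [exact/bZ/bM|exact: bZ].
rewrite simplex_intD; [|exact/bZ/bM|exact: bZ].
by rewrite (simplex_intZ _ (bpmf x)) (simplex_intZ _ (bM bG)) (simplex_intZ _ (bM (bcoord i)))
  (simplex_intZ _ (bM (bGcoord i))) (simplex_intZ _ bE2).
Qed.

(* The Bayes rule of the truncated prior improves on the untruncated one by at
   most the truncated mass divided by N; this is where eps ^ alpha * N -> 0 is
   needed. *)
Lemma observation_gain_le (q : 'I_k -> R) : (forall i, 0 < q i) -> \sum_i q i = 1 ->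
  \sum_i T1 i * (ln (q i) - ln (p i)) <= k%:R * (M - T) / (A + 1).
Proof.
move=> q0 sq; have /andP[e0 e1] := e01.
have A1 : 0 < A + 1 by rewrite addr_gt0.
have sT1 : \sum_i T1 i = T.
  rewrite /T1 -simplex_int_sum => [|i]; last exact: bM.
  apply: eq_Rintegral => theta _; rewrite -mulr_sumr -mulr_sumr sum_coord//.
  by rewrite mulr1.
have T1_ge i : eps * T <= T1 i.
  rewrite /T -simplex_intZ; last exact: bM.
  apply: le_simplex_int; [|exact: bM|].
    by apply: simplex_boundedM; [exact: simplex_bounded_cst|exact: bM].
  move=> theta D; rewrite mulrCA ler_wpM2l ?multinomial_pmf_ge0// mulrC indicE.
  by case: (boolP (_ \in _)) => [/[!inE]-[_ h]|_]; rewrite ?mul1r ?mul0r.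
have R0 : 0 <= k%:R * (M - T) / (A + 1) by rewrite divr_ge0 ?mulr_ge0 ?subr_ge0// ltW.
(* [sum_ln_ratio_le] needs [T > 0]; when [T = 0] every [T1 i] is 0 as well. *)
have [T0|T0] := leP T 0.
  have T00 : T = 0 by apply/eqP; rewrite eq_le T0 T_ge0.
  have T10 i : T1 i = 0.
    apply/eqP; rewrite eq_le (le_trans _ (T1_ge i)) ?T00 ?mulr0// andbT -T00 -sT1.
    rewrite (bigD1 i)//= lerDl sumr_ge0// => j _.
    by rewrite (le_trans _ (T1_ge j))// T00 mulr0.
  by rewrite big1// => i _; rewrite T10 mul0r.
apply: le_trans (sum_ln_ratio_le T0 _ p_gt0 q0 sT1 sum_p sq) _.
  by move=> i; apply: lt_le_trans (T1_ge i); rewrite mulr_gt0.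
(* Dividing the covariance bound by [T * p i] leaves [(1 - p i) (M - T) / (A + 1)], and
   [1 - p i <= 1]. *)
rewrite -mulrA mulr_natl -[X in _ *+ X](card_ord k) -sumr_const; apply: ler_sum => i _.
have Tp : 0 < T * p i by exact: mulr_gt0 T0 (p_gt0 i).
rewrite ler_pdivrMr//; apply: le_trans (cauchy_schwarz i) _.
have -> : (M - T) / (A + 1) * (T * p i) = T * (M - T) * (p i * 1 / (A + 1)) by ring.
have MT : 0 <= M - T by rewrite subr_ge0.
rewrite (ler_wpM2l (mulr_ge0 T_ge0 MT))// ler_pM2r ?invr_gt0// (ler_pM2l (p_gt0 i)) gerBl.
exact: ltW (p_gt0 i).
Qed.

End Observation.

Lemma minimax_lower (q : counts k N -> counts k 1 -> R) (S : R) : (0 < N)%N ->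
  (forall x y, 0 < q x y) -> (forall x, \sum_y q x y = 1) ->
  (forall theta, Delta_eps k eps theta -> risk_real theta q <= S) ->
  (@risk_main R k N - S) * simplex_int G <=
  4 * k%:R / (N%:R ^+ 3 * eps) + k%:R * (k%:R * eps `^ alpha_hat) / N%:R.
Proof.
move=> N0 q0 sq qS; have /andP[e0 e1] := e01.
have N00 : 0 < N%:R :> R by rewrite ltr0n.
pose qd := @bayes_predictive R k N (dirichlet_density k alpha_hat).
have qdE x i : qd x (obs i) = dirichlet_pred x i by exact: bayes_predictive_dirichlet.
pose l x i : R := ln (q x (obs i)) - ln (dirichlet_pred x i).
(* On the truncated simplex the risk of the Dirichlet rule exceeds that of [q] by the expected
   log-ratio [l], so [h] dominates [risk_main - S] there; both sides of the comparison vanish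
   outside it. *)
pose h theta := \sum_i (4 / N%:R ^+ 3) * eps_inv2 eps i theta +
  \sum_(x : counts k N) \sum_i l x i * (multinomial_pmf theta x * (G theta * coord theta i)).
have bZ F c : simplex_bounded F -> simplex_bounded (fun theta => c * F theta).
  by move=> bF; apply: simplex_boundedM => //; exact: simplex_bounded_cst.
have binv i : simplex_bounded (fun theta => (4 / N%:R ^+ 3) * eps_inv2 eps i theta).
  by apply: bZ; exact: simplex_bounded_inv2.
have bpm (x : counts k N) i : simplex_bounded (fun theta =>
    multinomial_pmf theta x * (G theta * coord theta i)).
  by apply: simplex_boundedM; [exact: bpmf|apply: simplex_boundedM; [exact: bG|exact: bcoord]].
have bl (x : counts k N) : simplex_bounded (fun theta =>
    \sum_i l x i * (multinomial_pmf theta x * (G theta * coord theta i))).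
  by apply: simplex_bounded_sum => i; exact: bZ.
have bh : simplex_bounded h.
  by apply: simplex_boundedD; exact: simplex_bounded_sum.
have pointwise theta : Delta k theta -> (@risk_main R k N - S) * G theta <= h theta.
  move=> D; rewrite /h /eps_inv2 indicE.
  case: (boolP (_ \in _)) => [/[!inE] Ge|_]; last first.
    rewrite mulr0 [X in X + _]big1 => [|i _]; last by rewrite mul0r mulr0.
    by rewrite add0r big1// => x _; rewrite big1// => i _; rewrite mul0r !mulr0.
  have t0 i : 0 < coord theta i by exact: lt_le_trans (Ge.2 i).
  have := risk_dirichlet_ge (ltn0Sn n) qdE N0 D t0.
  have -> : risk_real theta qd = risk_real theta q + \sum_x \sum_i
      l x i * (multinomial_pmf theta x * (true%:R * coord theta i)).
    rewrite exchange_big -big_split/=; apply: eq_bigr => i _.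
    rewrite -big_split/=; apply: eq_bigr => x _.
    by rewrite qdE /l; ring.
  have -> : \sum_i 4 / N%:R ^+ 3 * (true%:R * coord theta i `^ (- 2)) =
      \sum_i 4 / (N%:R ^+ 3 * coord theta i ^+ 2).
    apply: eq_bigr => i _; rewrite powR_invn ?(D i)// mul1r.
    by rewrite -mulrA -invfM.
  by have := qS _ Ge; rewrite mulr1; lra.
have := le_simplex_int (bZ _ (@risk_main R k N - S) bG) bh pointwise.
rewrite simplex_intZ// => /le_trans; apply.
rewrite simplex_intD; [|exact: simplex_bounded_sum|exact: simplex_bounded_sum].
rewrite !simplex_int_sum//; apply: lerD.
  apply: (@le_trans _ _ (\sum_(i < k) (4 / N%:R ^+ 3) / eps)).
    apply: ler_sum => i _; rewrite simplex_intZ; last exact: simplex_bounded_inv2.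
    by rewrite ler_wpM2l ?divr_ge0 ?exprn_ge0 ?simplex_int_inv2_le.
  rewrite sumr_const card_ord -[_ *+ k]mulr_natl.
  by rewrite -mulrA -invfM mulrCA mulrA.
have A1N : (A + 1)^-1 <= N%:R^-1.
  have /andP[a1 _] := @alpha_hat_bounds R.
  have A10 : 0 < A + 1 by rewrite addr_gt0.
  have ka0 : 0 <= k%:R * alpha_hat :> R by rewrite mulr_ge0//; lra.
  by rewrite lef_pV2 ?posrE// -addrA lerDl addr_ge0.
(* The probabilities of [x] sum to 1, so the losses [M - T] add up to the mass outside the truncated
   simplex. *)
have sT : \sum_(x : counts k N) (simplex_int (fun theta => multinomial_pmf theta x) -
    simplex_int (fun theta => multinomial_pmf theta x * G theta)) <= k%:R * eps `^ alpha_hat.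
  apply: le_trans (simplex_int_out_le n0 e01).
  rewrite sumrB -!simplex_int_sum//; last by move=> x; exact: simplex_boundedM.
  rewrite simplex_intD//; [|exact: simplex_bounded_cst|exact: bZ].
  rewrite simplex_intZ// mulN1r; apply: lerB.
    by apply: le_simplex_int; [exact: simplex_bounded_sum|exact: simplex_bounded_cst|
      move=> theta D; rewrite sum_multinomial_pmf].
  apply: le_simplex_int => //; first by apply: simplex_bounded_sum => x; exact: simplex_boundedM.
  by move=> theta D; rewrite -mulr_suml sum_multinomial_pmf// mul1r.
apply: (@le_trans _ _ (\sum_(x : counts k N) k%:R * (simplex_int (fun theta => multinomial_pmf theta x) -
    simplex_int (fun theta => multinomial_pmf theta x * G theta)) / (A + 1))).
  apply: ler_sum => x _; rewrite simplex_int_sum// => [|i]; last exact: bZ.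
  apply: le_trans (observation_gain_le x (fun i => q0 x (obs i)) _); last by rewrite -sum_obs.
  by apply: ler_sum => i _; rewrite simplex_intZ// mulrC.
rewrite -mulr_suml -mulr_sumr; apply: ler_pM => //.
- rewrite mulr_ge0// sumr_ge0// => x _; rewrite subr_ge0.
  apply: le_simplex_int => //; first exact: simplex_boundedM.
  by move=> theta D; rewrite ler_piMr ?multinomial_pmf_ge0// indicE lern1; case: (_ \in _).
- by rewrite invr_ge0 ltW// addr_gt0.
- by rewrite ler_wpM2l.
Qed.

End Minimax.

(** * Finiteness of the suprema and bounds for the minimax risk *)

Section SupRisk.
Context {R : realType} {n : nat}.
Local Notation k := n.+1.
Implicit Types (theta : k.-1.-tuple R) (i : 'I_k).
Context (eps : R) (e01 : 0 < eps < k%:R^-1) (N : nat).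
Implicit Types (q : counts k N -> counts k 1 -> R).

Lemma obs_surj (y : counts k 1) : exists i, y = obs i.
Proof. by case: (@obs_bij k) => g _ gK; exists (g y); rewrite gK. Qed.

(** The barycentre belongs to the set, so that no supremum is the [-oo] of an empty set. *)
Lemma Delta_eps_neq0 : exists theta, Delta_eps k eps theta.
Proof.
have /andP[e0 ek] := e01.
pose theta : k.-1.-tuple R := nseq_tuple k.-1 k%:R^-1.
have k0 : 0 < k%:R :> R by rewrite ltr0n.
have ci i : coord theta i = k%:R^-1.
  have [->|ni] := eqVneq i ord_max.
    rewrite coord_last big_nseq iter_addr_0 -[X in 1 - X]mulr_natl /=.
    have kn0 := lt0r_neq0 k0.
    apply: (mulfI kn0); rewrite mulrBr mulrCA (mulfV kn0) !mulr1 -(natr1 n).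
    by rewrite addrAC subrr add0r.
  have ilt : (i < n)%N by rewrite ltn_neqAle -ltnS ltn_ord andbT.
  have -> : i = widen_ord (leqnSn n) (Ordinal ilt) by exact: val_inj.
  by rewrite coord_widen (tnth_nth 0) nth_nseq ilt.
by exists theta; split=> i; rewrite ci ?ltW// invr_ge0.
Qed.

Let coord_gt0 theta i : Delta_eps k eps theta -> 0 < coord theta i.
Proof. by move=> [_ h]; have /andP[e0 _] := e01; exact: lt_le_trans (h i). Qed.

Let sum_obs1 q x : predictive_density k N q -> \sum_i q x (obs i) = 1.
Proof. by move=> /(_ x)[_]; rewrite sum_obs. Qed.

Lemma risk_real_ge0 theta q : predictive_density k N q -> (forall x y, 0 < q x y) ->
  Delta_eps k eps theta -> 0 <= risk_real theta q.
Proof.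
move=> pq q0 D; rewrite /risk_real exchange_big; apply: sumr_ge0 => x _.
apply: (@le_trans _ _ (\sum_i multinomial_pmf theta x * (coord theta i - q x (obs i)))).
  by rewrite -mulr_sumr sumrB sum_coord// sum_obs1// subrr mulr0.
apply: ler_sum => i _; rewrite -mulrA ler_wpM2l ?(multinomial_pmf_ge0 _ D.1)//.
have t0 := coord_gt0 i D; have qi := q0 x (obs i).
have := ler_wpM2l (ltW t0) (ln_le_subr1 (divr_gt0 qi t0)); rewrite ln_div ?posrE//.
have -> : coord theta i * (q x (obs i) / coord theta i - 1) = q x (obs i) - coord theta i.
  by field; rewrite gt_eqF.
lra.
Qed.

(** A crude bound free of [theta], from [ln (coord theta i) <= 0]; it makes the supremum finite. *)
Lemma risk_real_le theta q : predictive_density k N q -> (forall x y, 0 < q x y) ->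
  Delta_eps k eps theta -> risk_real theta q <= \sum_i \sum_x `|ln (q x (obs i))|.
Proof.
move=> pq q0 D; apply: ler_sum => i _; apply: ler_sum => x _.
have t0 := coord_gt0 i D; have t1 := @coord_le1 R k (ltn0Sn n) theta i D.1.
have m0 := multinomial_pmf_ge0 x D.1.
have m1 : multinomial_pmf theta x <= 1.
  rewrite -(@sum_multinomial_pmf R k N theta)// (bigD1 x)//= lerDl sumr_ge0// => z _.
  exact: multinomial_pmf_ge0 D.1.
apply: (@le_trans _ _ (multinomial_pmf theta x * coord theta i * `|ln (q x (obs i))|)).
  apply: (ler_wpM2l (mulr_ge0 m0 (ltW t0))).
  have : ln (coord theta i) <= 0 by rewrite ln_le0.
  by have := ler_norm (- ln (q x (obs i))); rewrite normrN; lra.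
by rewrite ler_piMl// (mulr_ile1 m0 (ltW t0) m1 t1).
Qed.

Lemma sup_risk_bounds q : predictive_density k N q -> (forall x y, 0 < q x y) ->
  (0 <= sup_risk eps q <= (\sum_i \sum_x `|ln (q x (obs i))|)%:E)%E.
Proof.
move=> pq q0; apply/andP; split.
  have [theta D] := Delta_eps_neq0.
  apply: (@le_trans _ _ (risk theta q)); last by apply: ereal_sup_ubound; exists theta.
  by rewrite riskE ?lee_fin ?risk_real_ge0// => i; exact: coord_gt0.
apply: ge_ereal_sup => _ [theta D <-].
by rewrite riskE ?lee_fin ?risk_real_le// => i; exact: coord_gt0.
Qed.

Lemma sup_risk_pinfty q : predictive_density k N q -> ~ (forall x y, 0 < q x y) ->
  sup_risk eps q = +oo%E.
Proof.
move=> pq nq; have [x [y qxy]] : exists x y, q x y = 0.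
  apply: contrapT => h; apply: nq => x y; rewrite lt_neqAle (pq x).1 andbT.
  by apply/eqP => e; apply: h; exists x, y.
have [theta D] := Delta_eps_neq0.
apply/eqP; rewrite -leye_eq -(@risk_pinfty R k N theta q x y)//.
- by apply: ereal_sup_ubound; exists theta.
- by move=> i; exact: coord_gt0.
- by move=> x' y'; exact: (pq x').1.
Qed.

Local Notation qB := (@bayes_predictive R k N (dirichlet_density k alpha_hat)).

Lemma bayes_predictive_gt0 x y : 0 < qB x y.
Proof.
have /andP[a1 _] := @alpha_hat_bounds R.
have [i ->] := obs_surj y; rewrite bayes_predictive_dirichlet /dirichlet_pred.
by rewrite divr_gt0// ltr_wpDl// ?mulr_gt0//; lra.
Qed.

Lemma bayes_predictive_density : predictive_density k N qB.
Proof.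
have /andP[a1 _] := @alpha_hat_bounds R.
move=> x; split=> [y|]; first exact/ltW/bayes_predictive_gt0.
rewrite sum_obs; under eq_bigr do rewrite bayes_predictive_dirichlet.
rewrite /dirichlet_pred -mulr_suml big_split/= -natr_sum sum_count_vec sumr_const card_ord.
rewrite -[alpha_hat *+ k]mulr_natl divff// gt_eqF// ltr_wpDl// mulr_gt0//; lra.
Qed.

Lemma minimax_risk_ge0 : (0 <= minimax_risk k N eps)%E.
Proof.
apply: le_ereal_inf_tmp => _ [q pq <-].
have [q0|q0] := pselect (forall x y, 0 < q x y); last by rewrite sup_risk_pinfty// leey.
by case/andP: (sup_risk_bounds pq q0).
Qed.

Lemma minimax_risk_le : (minimax_risk k N eps <= sup_risk eps qB)%E.
Proof. by apply: ereal_inf_lbound; exists qB => //; exact: bayes_predictive_density. Qed.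

Lemma sup_risk_bayes_fin_num : sup_risk eps qB \is a fin_num.
Proof.
have /andP[s0 s1] := sup_risk_bounds bayes_predictive_density bayes_predictive_gt0.
by rewrite ge0_fin_numE// (le_lt_trans s1)// ltry.
Qed.

Lemma minimax_risk_fin_num : minimax_risk k N eps \is a fin_num.
Proof.
rewrite ge0_fin_numE ?minimax_risk_ge0// (le_lt_trans minimax_risk_le)//.
by rewrite -ge0_fin_numE ?sup_risk_bayes_fin_num// (le_trans minimax_risk_ge0 minimax_risk_le).
Qed.

Lemma sup_risk_bayes_le : 20 <= N%:R * eps -> (sup_risk eps qB <= (@risk_main R k N)%:E)%E.
Proof.
move=> Ne; apply: ge_ereal_sup => _ [theta D <-].
rewrite riskE ?lee_fin; last 2 first.
- by move=> i; exact: coord_gt0.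
- exact: bayes_predictive_gt0.
apply: risk_dirichlet_le => // [x i||i|i].
- exact: bayes_predictive_dirichlet.
- exact: D.1.
- exact: coord_gt0.
- by apply: le_trans Ne _; rewrite ler_wpM2l//; exact: D.2.
Qed.

Let e1 : 0 < eps < 1.
Proof.
have /andP[-> e] := e01; apply: lt_le_trans e _.
by rewrite invf_le1 ?ltr0n// ler1n.
Qed.

Lemma minimax_risk_ge (n0 : (0 < n)%N) (N0 : (0 < N)%N) (z : R) : 0 < z ->
  z <= simplex_int (\1_(Delta_eps k eps) : k.-1.-tuple R -> R) ->
  ((@risk_main R k N - (4 * k%:R / (N%:R ^+ 3 * eps) +
      k%:R * (k%:R * eps `^ alpha_hat) / N%:R) / z)%:E <= minimax_risk k N eps)%E.
Proof.
move=> z0 zZ; apply: le_ereal_inf_tmp => _ [q pq <-].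
have [q0|q0] := pselect (forall x y, 0 < q x y); last by rewrite sup_risk_pinfty// leey.
have /andP[s0 s1] := sup_risk_bounds pq q0.
have sfin : sup_risk eps q \is a fin_num by rewrite ge0_fin_numE// (le_lt_trans s1)// ltry.
rewrite -(fineK sfin) lee_fin.
have qS theta : Delta_eps k eps theta -> risk_real theta q <= fine (sup_risk eps q).
  move=> D; rewrite -lee_fin fineK// -riskE// => [|i]; last exact: coord_gt0.
  by apply: ereal_sup_ubound; exists theta.
have := minimax_lower n0 e1 N0 q0 (fun x => (pq x).2) qS.
set B := _ + _ / N%:R; set S := fine _; set Z := simplex_int _ in zZ * => h.
(* If [S] already reaches [risk_main] the bound is immediate; otherwise [risk_main - S] is positive
   and the truncated mass may be replaced by its lower bound [z]. *)
have [|SU] := leP (@risk_main R k N) S.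
  apply: le_trans; rewrite lerBlDr lerDl divr_ge0 ?(ltW z0)// /B.
  have /andP[e0 _] := e01.
  by rewrite addr_ge0 ?divr_ge0 ?mulr_ge0 ?exprn_ge0 ?powR_ge0 ?(ltW e0).
rewrite lerBlDr addrC -lerBlDr ler_pdivlMr//.
by apply: le_trans h; rewrite ler_wpM2l// subr_ge0 ltW.
Qed.

End SupRisk.

(** * Consequences of the growth conditions on [eps] *)

Section Asymptotics.
Context {R : realType} (eps : nat -> R) (eps01 : forall N, 0 < eps N < 1).
Context (eps_lb : (N%:R `^ (3 / 4) * eps N) @[N --> \oo] --> +oo).
Context (eps_ub : (N%:R `^ alpha_hat^-1 * eps N) @[N --> \oo] --> (0 : R)).

Lemma cvg_mul_eps (K : R) : \forall N \near \oo, K <= N%:R * eps N.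
Proof.
move/cvgryPge: eps_lb => /(_ K) h; near=> N.
have /andP[e0 _] := eps01 N.
have N1 : (1 <= N)%N by near: N; exact: nbhs_infty_ge.
apply: (@le_trans _ _ (N%:R `^ (3 / 4) * eps N)); first by near: N.
rewrite ler_wpM2r ?(ltW e0)// -[leRHS](powRr1 (ler0n _ N)).
by rewrite ler_powR ?ler1n//; lra.
Unshelve. all: by end_near. Qed.

Lemma cvg_mul_eps_powR (d : R) : 0 < d -> \forall N \near \oo, N%:R * eps N `^ alpha_hat <= d.
Proof.
move=> d0; have /andP[a1 _] := @alpha_hat_bounds R.
(* The cap at 1 ensures [t^a <= t] for [t = N^(1/a) eps], whose power [t^a] is [N eps^a]. *)
have m0 : 0 < Num.min d 1 by rewrite lt_min d0 ltr01.
move/cvgr0Pnorm_le : eps_ub => /(_ _ m0) h; near=> N.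
have /andP[e0 _] := eps01 N.
have : `|N%:R `^ alpha_hat^-1 * eps N| <= Num.min d 1 by near: N.
rewrite ger0_norm ?mulr_ge0 ?powR_ge0 ?(ltW e0)// le_min => /andP[bd b1].
have N0 : 0 < N%:R :> R by rewrite ltr0n; near: N; exact: nbhs_infty_gt.
apply: le_trans bd; have -> : N%:R * eps N `^ alpha_hat = (N%:R `^ alpha_hat^-1 * eps N) `^ alpha_hat.
  rewrite powRM ?powR_ge0 ?(ltW e0)// -powRrM mulVf ?powRr1 ?(ltW N0)//.
  by rewrite gt_eqF//; lra.
rewrite ge1r_powR//; last by lra.
by rewrite b1 andbT mulr_gt0// powR_gt0.
Unshelve. all: by end_near. Qed.

End Asymptotics.

(** * Assembly of the upper and lower bounds *)

Theorem theorem3 (R : realType) (k : nat) (eps : nat -> R) :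
  (2 <= k)%N ->
  nonincreasing_seq eps ->
  (N%:R `^ (3 / 4) * eps N) @[N --> \oo] --> +oo ->
  (N%:R `^ alpha_hat^-1 * eps N) @[N --> \oo] --> (0 : R) ->
  (forall N, 0 < eps N < k%:R^-1) ->
  (forall N, minimax_risk k N (eps N) \is a fin_num) /\
  exists2 r : nat -> R^o,
    r =o_\oo (fun N => (N%:R ^- 2 : R^o)) &
    forall N,
      (sup_risk (eps N) (bayes_predictive N (dirichlet_density k alpha_hat))
       = minimax_risk k N (eps N) + (r N)%:E)%E.
Proof.
case: k => [//|n]; rewrite ltnS => n0 _ lb ub e0k.
have minfin N : minimax_risk n.+1 N (eps N) \is a fin_num by exact: minimax_risk_fin_num.
have supfin N := sup_risk_bayes_fin_num (e0k N) N.
split=> //.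
exists (fun N => fine (sup_risk (eps N) (bayes_predictive N (dirichlet_density n.+1 alpha_hat))) -
    fine (minimax_risk n.+1 N (eps N))); last first.
  by move=> N; rewrite EFinB !fineK// [RHS]addeC subeK.
have e01 N : 0 < eps N < 1.
  have /andP[-> e] := e0k N; apply: lt_le_trans e _.
  by rewrite invf_le1 ?ltr0n// ler1n.
pose W : R := @simplex_int R n (fun=> 1).
have W0 : 0 < W.
  have := @moment_gt0 R n [ffun=> 0%N]; congr (_ < _).
  by apply: eq_Rintegral => theta _; rewrite big1// => i _; rewrite ffunE expr0.
(* Half of the total mass [W]: a lower bound for the truncated mass once [ubz] makes the removed
   mass at most [W / 2]. *)
pose z := W / 2; have z0 : 0 < z by rewrite divr_gt0.
pose K : R := n.+1%:R.
have K0 : 0 < K by rewrite ltr0n.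
apply/eqoP => d d0.
near=> N.
have N0 : (0 < N)%N by near: N; exact: nbhs_infty_gt.
have N00 : 0 < N%:R :> R by rewrite ltr0n.
have /andP[eN0 eN1] := e01 N.
have lb20 : 20 <= N%:R * eps N by near: N; exact: cvg_mul_eps.
(* The thresholds in [lbd] and [ubd] make each of the two error terms of [minimax_risk_ge], before
   division by [z], at most [(d z / 2) / N^2]. *)
have lbd : 4 * K / (d * z / 2) <= N%:R * eps N by near: N; exact: cvg_mul_eps.
have ubz : N%:R * eps N `^ alpha_hat <= z / K.
  by near: N; apply: cvg_mul_eps_powR => //; exact: divr_gt0.
have ubd : N%:R * eps N `^ alpha_hat <= (d * z / 2) / (K * K).
  by near: N; apply: cvg_mul_eps_powR => //; rewrite divr_gt0 ?mulr_gt0.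
have zZ : z <= simplex_int (\1_(Delta_eps n.+1 (eps N)) : n.+1.-1.-tuple R -> R).
  have := simplex_int_out_le n0 (e01 N).
  rewrite simplex_intD; [|exact: simplex_bounded_cst|]; last first.
    by apply: simplex_boundedM; [exact: simplex_bounded_cst|exact: simplex_bounded_indic].
  rewrite simplex_intZ; last exact: simplex_bounded_indic.
  have : K * eps N `^ alpha_hat <= z.
    rewrite mulrC -ler_pdivlMr//; apply: le_trans ubz.
    by rewrite ler_peMl ?powR_ge0// ler1n.
  by rewrite /z -/W -/K; set Z := simplex_int _; lra.
have lower := minimax_risk_ge (e0k N) n0 N0 z0 zZ.
have upper := sup_risk_bayes_le (e0k N) lb20.
have ge0 := @minimax_risk_le R n (eps N) N.
rewrite -(fineK (minfin N)) lee_fin in lower.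
rewrite -(fineK (supfin N)) lee_fin in upper.
rewrite -(fineK (minfin N)) -(fineK (supfin N)) lee_fin in ge0.
move: lower upper ge0.
set m := fine _; set u := risk_main _; set B := _ + _ / N%:R; set s := fine (sup_risk _ _).
move=> lower upper sm.
rewrite ger0_norm ?subr_ge0// ger0_norm; last by rewrite invr_ge0 exprn_ge0.
have : B / z <= d / N%:R ^+ 2.
  rewrite ler_pdivrMr// /B.
  have -> : d / N%:R ^+ 2 * z = (d * z / 2) / N%:R ^+ 2 + (d * z / 2) / N%:R ^+ 2.
    by field; rewrite gt_eqF.
  apply: lerD.
    move: lbd; rewrite ler_pdivrMr ?divr_gt0 ?mulr_gt0// -/K => lbd.
    have -> : 4 * K / (N%:R ^+ 3 * eps N) = 4 * K / (N%:R * eps N) / N%:R ^+ 2.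
      by field; rewrite !gt_eqF.
    by rewrite ler_pM2r ?invr_gt0 ?exprn_gt0// ler_pdivrMr ?mulr_gt0// [leRHS]mulrC.
  have -> : K * (K * eps N `^ alpha_hat) / N%:R = (N%:R * eps N `^ alpha_hat) * (K * K) / N%:R ^+ 2.
    by field; rewrite gt_eqF.
  by rewrite ler_pM2r ?invr_gt0 ?exprn_gt0// -ler_pdivlMr ?mulr_gt0.
move: lower upper sm; lra.
Unshelve. all: by end_near. Qed.
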